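(* Let $\Gamma$ be a finite simple graph with an edge $\alpha\beta$ such that the graph obtained from $\Gamma$ by deleting the edge $\alpha\beta$ is the disjoint union of two subgraphs $\Gamma_\alpha\ni\alpha$ and $\Gamma_\beta\ni\beta$ with no edges between them. Then the algebra $H(\Gamma)$ is generated by: the images in $H(\Gamma)$ of the homology classes of $\Gamma_\alpha$ and of $\Gamma_\beta$ (under the maps $H(\Gamma_\alpha)\to H(\Gamma)$, $H(\Gamma_\beta)\to H(\Gamma)$ induced by the inclusions), and the stars at the vertices $\alpha$ and $\beta$, i.e. the classes $\big[\tfrac1\alpha d\bigwedge_{i\in I}e_{t_i\alpha}\big]$ and $\big[\tfrac1\beta d\bigwedge_{j\in J}e_{t_j\beta}\big]$ for sets $I$, $J$ of neighbours of $\alpha$, resp. $\beta$, in $\Gamma$.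
   Context: Let $\Bbbk$ be a field. For a finite simple graph $\Gamma$ with vertices $t_1,\dots,t_s$, put $A=\Bbbk[t_1,\dots,t_s]$. For every edge $\{t_i,t_j\}$ take a generator $e_{t_it_j}$ of degree 1. The Koszul complex $K(\Gamma)$ is the exterior algebra over $A$ on these generators with the $A$-linear differential (graded derivation) determined by $d(e_{t_it_j})=t_it_j$; $H(\Gamma)$ is its homology algebra (product induced by $\wedge$). For a subgraph $\Gamma'\subseteq\Gamma$ the inclusion $\Bbbk[V(\Gamma')]\subseteq A$, $e_{t_it_j}\mapsto e_{t_it_j}$ gives a morphism of complexes $K(\Gamma')\to K(\Gamma)$ and hence a map $H(\Gamma')\to H(\Gamma)$. For a vertex $x$ with distinct neighbours $y_1,\dots,y_k$, $k\ge1$, the star is $\star_x(y_1,\dots,y_k)=[\tfrac1x d(e_{xy_1}\wedge\dots\wedge e_{xy_k})]$ (division of all coefficients by $x$). *)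

(* Defs.v *)
From HB Require Import structures.
From mathcomp Require Import all_boot all_order all_algebra.
From mathcomp Require Import boolp.
From mathcomp.multinomials Require Import mpoly.

Set Implicit Arguments.
Unset Strict Implicit.
Unset Printing Implicit Defensive.

Import GRing.Theory.
Local Open Scope ring_scope.

Section ExteriorRing.
Variables (A : comNzRingType) (I : finType).

(* Exterior algebra of the free A-module with basis (e_i)_(i : I): the
   coefficient u S is that of e_{i1} /\ ... /\ e_{ir}, where i1 < ... < ir are
   the elements of S listed in the order of [enum I]; see [ext_basisE]. *)
Definition exterior := {ffun {set I} -> A}.

HB.instance Definition _ := GRing.Zmodule.on exterior.

Implicit Types (i j : I) (S T U V W : {set I}) (u v w : exterior) (a : A).

Definition ext_lt i j := (enum_rank i < enum_rank j)%N.

Definition ext_sign1 i j : A :=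
  if ext_lt i j then 1 else if ext_lt j i then -1 else 0.

(* e_U /\ e_V = ext_sign U V *: e_(U :|: V); it vanishes when U meets V. *)
Definition ext_sign U V : A :=
  \prod_(i in U) \prod_(j in V) ext_sign1 i j.

Definition ext_mul u v : exterior :=
  [ffun S => \sum_U \sum_(V | U :|: V == S) ext_sign U V * u U * v V].

Definition ext_const a : exterior := [ffun S => if S == set0 then a else 0].

Definition ext_gen i : exterior := [ffun S => (S == [set i])%:R].

Lemma ext_lt_trans : transitive ext_lt.
Proof. by move=> y x z; apply: ltn_trans. Qed.

Lemma ext_lt_irr i : ext_lt i i = false.
Proof. exact: ltnn. Qed.

Lemma ext_sign1_ii i : ext_sign1 i i = 0.
Proof. by rewrite /ext_sign1 ext_lt_irr. Qed.

Lemma ext_sign1N i j : ext_sign1 j i = - ext_sign1 i j.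
Proof.
rewrite /ext_sign1 /ext_lt; case: ltngtP => _; rewrite ?opprK ?oppr0 //.
Qed.

Lemma ext_sign1_sq i j : i != j -> ext_sign1 i j * ext_sign1 i j = 1.
Proof.
move=> nij; rewrite /ext_sign1 /ext_lt; case: ltngtP => [_|_|/ord_inj/enum_rank_inj eij].
- by rewrite mulr1.
- by rewrite mulrNN mulr1.
- by rewrite eij eqxx in nij.
Qed.

Lemma ext_sign0l V : ext_sign set0 V = 1.
Proof. by rewrite /ext_sign big_set0. Qed.

Lemma ext_sign0r U : ext_sign U set0 = 1.
Proof. by rewrite /ext_sign big1 // => i _; rewrite big_set0. Qed.

Lemma ext_sign_meet i U V : i \in U -> i \in V -> ext_sign U V = 0.
Proof.
move=> iU iV; rewrite /ext_sign (bigD1 i) //= [X in X * _](bigD1 i) //=.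
by rewrite ext_sign1_ii !mul0r.
Qed.

Lemma ext_sign_ndisj U V : ~~ [disjoint U & V] -> ext_sign U V = 0.
Proof.
rewrite -setI_eq0 => /set0Pn [i]; rewrite inE => /andP [iU iV].
exact: ext_sign_meet iU iV.
Qed.

Lemma ext_signUl U V W : [disjoint U & V] ->
  ext_sign (U :|: V) W = ext_sign U W * ext_sign V W.
Proof.
move=> dUV; rewrite /ext_sign -bigU //=.
by apply: eq_bigl => i; rewrite !inE.
Qed.

Lemma ext_signUr U V W : [disjoint V & W] ->
  ext_sign U (V :|: W) = ext_sign U V * ext_sign U W.
Proof.
move=> dVW; rewrite /ext_sign -big_split /=; apply: eq_bigr => i _.
by rewrite -bigU //=; apply: eq_bigl => j; rewrite !inE.
Qed.

Lemma ext_sign_cocycle U V W :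
  ext_sign (U :|: V) W * ext_sign U V = ext_sign U (V :|: W) * ext_sign V W.
Proof.
have [dUV|nUV] := boolP [disjoint U & V]; last first.
  rewrite (ext_sign_ndisj nUV) mulr0.
  move: nUV; rewrite -setI_eq0 => /set0Pn [i]; rewrite inE => /andP [iU iV].
  by rewrite (@ext_sign_meet i U) ?mul0r // inE iV.
have [dVW|nVW] := boolP [disjoint V & W]; last first.
  rewrite (ext_sign_ndisj nVW) mulr0.
  move: nVW; rewrite -setI_eq0 => /set0Pn [i]; rewrite inE => /andP [iV iW].
  by rewrite (@ext_sign_meet i _ W) ?mul0r // inE iV orbT.
by rewrite ext_signUl // ext_signUr // mulrC mulrA.
Qed.

Lemma ext_mulA : associative ext_mul.
Proof.
move=> u v w; apply/ffunP => S; rewrite !ffunE.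
transitivity (\sum_U \sum_V \sum_(W | U :|: (V :|: W) == S)
    ext_sign U (V :|: W) * ext_sign V W * (u U * v V * w W)).
  apply: eq_bigr => U _.
  under eq_bigr => P _ do rewrite ffunE mulr_sumr.
  rewrite exchange_big /=; apply: eq_bigr => V _.
  under eq_bigr => P _ do rewrite mulr_sumr.
  rewrite (exchange_big_dep predT) //= big_mkcond [RHS]big_mkcond /=.
  apply: eq_bigr => W _.
  case: (U :|: (V :|: W) =P S) => [e|ne]; last first.
    by rewrite big1 // => P /andP [/eqP eP /eqP eQ]; case: ne; rewrite eQ.
  rewrite (big_pred1 (V :|: W)) => [|P /=].
    by rewrite -!mulrA; congr (_ * _); rewrite mulrCA; congr (_ * _).
  by apply/andP/eqP => [[_ /eqP <-]|->]; rewrite ?e ?eqxx.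
under [RHS]eq_bigr => P _.
  under eq_bigr => W _.
    rewrite ffunE mulr_sumr mulr_suml.
    over.
  over.
transitivity (\sum_P \sum_(W | P :|: W == S) \sum_U \sum_(V | U :|: V == P)
    ext_sign P W * (ext_sign U V * u U * v V) * w W); last first.
  apply: eq_bigr => P _; apply: eq_bigr => W _; apply: eq_bigr => U _.
  by rewrite mulr_sumr mulr_suml.
symmetry.
transitivity (\sum_U \sum_P \sum_(W | P :|: W == S) \sum_(V | U :|: V == P)
    ext_sign P W * (ext_sign U V * u U * v V) * w W).
  rewrite exchange_big /=; apply: eq_bigr => P _; by rewrite exchange_big.
apply: eq_bigr => U _.
transitivity (\sum_P \sum_V \sum_(W | (P :|: W == S) && (U :|: V == P))
    ext_sign P W * (ext_sign U V * u U * v V) * w W).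
  apply: eq_bigr => P _; rewrite (exchange_big_dep predT) //=.
rewrite exchange_big /=; apply: eq_bigr => V _.
rewrite (exchange_big_dep predT) //= [RHS]big_mkcond /=.
apply: eq_bigr => W _.
rewrite setUA; case: (U :|: V :|: W =P S) => [e|ne]; last first.
  by rewrite big1 // => P /andP [/eqP eP /eqP eQ]; case: ne; rewrite eQ.
rewrite (big_pred1 (U :|: V)) => [|P /=].
  rewrite -ext_sign_cocycle -!mulrA; congr (_ * _); congr (_ * _).
by apply/andP/eqP => [[_ /eqP <-]|->]; rewrite ?e ?eqxx.
Qed.

Lemma ext_mul1 : left_id (ext_const 1) ext_mul.
Proof.
move=> u; apply/ffunP => S; rewrite !ffunE (bigD1 set0) //= [X in _ + X]big1.
  rewrite addr0 (big_pred1 S) => [|V]; last by rewrite set0U.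
  by rewrite ffunE eqxx ext_sign0l !mul1r.
by move=> U nU; rewrite big1 // => V _; rewrite ffunE (negPf nU) mulr0 mul0r.
Qed.

Lemma ext_mul1r : right_id (ext_const 1) ext_mul.
Proof.
move=> u; apply/ffunP => S; rewrite !ffunE (bigD1 S) //= [X in _ + X]big1.
  rewrite addr0 (bigD1 set0) ?setU0 //= big1.
    by rewrite ffunE eqxx ext_sign0r mul1r mulr1 addr0.
  by move=> V /andP [_ nV]; rewrite ffunE (negPf nV) mulr0.
move=> U nU; rewrite big1 // => V /eqP eV; rewrite ffunE.
case: (V =P set0) => [V0|]; last by rewrite mulr0.
by rewrite -eV V0 setU0 eqxx in nU.
Qed.

Lemma ext_mulDl : left_distributive ext_mul +%R.
Proof.
move=> u v w; apply/ffunP => S; rewrite !ffunE -big_split /=.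
apply: eq_bigr => U _; rewrite -big_split /=; apply: eq_bigr => V _.
by rewrite ffunE mulrDr mulrDl.
Qed.

Lemma ext_mulDr : right_distributive ext_mul +%R.
Proof.
move=> u v w; apply/ffunP => S; rewrite !ffunE -big_split /=.
apply: eq_bigr => U _; rewrite -big_split /=; apply: eq_bigr => V _.
by rewrite ffunE mulrDr.
Qed.

Lemma ext_one_neq0 : ext_const 1 != 0.
Proof. by apply/eqP => /ffunP /(_ set0) /eqP; rewrite !ffunE eqxx oner_eq0. Qed.

HB.instance Definition _ := GRing.Zmodule_isNzRing.Build exterior
  ext_mulA ext_mul1 ext_mul1r ext_mulDl ext_mulDr ext_one_neq0.

Lemma extM u v S :
  (u * v) S = \sum_U \sum_(V | U :|: V == S) ext_sign U V * u U * v V.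
Proof. by rewrite ffunE. Qed.

Lemma extconstMl a u S : (ext_const a * u) S = a * u S.
Proof.
rewrite extM (bigD1 set0) //= [X in _ + X]big1.
  rewrite addr0 (big_pred1 S) => [|V]; last by rewrite set0U.
  by rewrite ffunE eqxx ext_sign0l !mul1r.
by move=> U nU; rewrite big1 // => V _; rewrite ffunE (negPf nU) mulr0 mul0r.
Qed.

Lemma extconstMr a u S : (u * ext_const a) S = a * u S.
Proof.
rewrite extM (bigD1 S) //= [X in _ + X]big1.
  rewrite addr0 (bigD1 set0) ?setU0 //= big1.
    by rewrite ffunE eqxx ext_sign0r mul1r addr0 mulrC.
  by move=> V /andP [_ nV]; rewrite ffunE (negPf nV) mulr0.
move=> U nU; rewrite big1 // => V /eqP eV; rewrite ffunE.
case: (V =P set0) => [V0|]; last by rewrite mulr0.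
by rewrite -eV V0 setU0 eqxx in nU.
Qed.

Lemma ext_constC a u : ext_const a * u = u * ext_const a.
Proof. by apply/ffunP => S; rewrite extconstMl extconstMr. Qed.

End ExteriorRing.

Arguments ext_gen A {I} i.
Arguments ext_const {A} I a.

Section ExteriorBasis.
Variables (A : comNzRingType) (I : finType).
Implicit Types (i j : I) (S T : {set I}) (u v w : exterior A I) (a : A).

Definition ext_monomial (R : nzRingType) (x : I -> R) S : R :=
  \prod_(i <- enum S) x i.

Lemma ext_sorted_enum S : sorted (@ext_lt I) (enum S).
Proof.
rewrite /enum_mem; apply: sorted_filter; first exact: ext_lt_trans.
suff: sorted (@ext_lt I) (enum I) by rewrite enumT.
case: (posnP #|I|) => [I0|]; first by rewrite (size0nil (esym (etrans (esym I0) (cardE I)))).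
case/card_gt0P => i0 _.
apply/(sortedP i0) => n ltn.
have lt1 : (n < #|I|)%N by rewrite cardE (ltn_trans _ ltn).
have lt2 : (n.+1 < #|I|)%N by rewrite cardE.
have -> : nth i0 (enum I) n = enum_val (Ordinal lt1).
  by rewrite (enum_val_nth i0).
have -> : nth i0 (enum I) n.+1 = enum_val (Ordinal lt2).
  by rewrite (enum_val_nth i0).
by rewrite /ext_lt !enum_valK /=.
Qed.

Lemma ext_enumU1 i S : {in S, forall j, ext_lt i j} ->
  enum (i |: S) = i :: enum S.
Proof.
move=> ltS.
apply: (irr_sorted_eq (@ext_lt_trans I) (@ext_lt_irr I)).
- exact: ext_sorted_enum.
- rewrite /= path_sortedE ?ext_sorted_enum ?andbT; last exact: ext_lt_trans.
  by apply/allP => j; rewrite mem_enum => /ltS.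
- by move=> j; rewrite inE !mem_enum !inE.
Qed.

Lemma ext_monomialU1 (R : nzRingType) (x : I -> R) i S :
  {in S, forall j, ext_lt i j} ->
  ext_monomial x (i |: S) = x i * ext_monomial x S.
Proof. by move=> ltS; rewrite /ext_monomial ext_enumU1 // big_cons. Qed.

Lemma ext_monomial0 (R : nzRingType) (x : I -> R) : ext_monomial x set0 = 1.
Proof. by rewrite /ext_monomial enum_set0 big_nil. Qed.

Lemma ext_set_ind (P : {set I} -> Prop) :
  P set0 ->
  (forall i S, {in S, forall j, ext_lt i j} -> P S -> P (i |: S)) ->
  forall S, P S.
Proof.
move=> P0 PS S; move: {2}#|S| (leqnn #|S|) => n.
elim: n S => [|n IHn] S; first by rewrite leqn0 cards_eq0 => /eqP ->.
case: (set_0Vmem S) => [-> //|[i0 i0S]] ltS.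
case: (@arg_minnP _ i0 (mem S) (fun i => enum_rank i) i0S) => i /= iS min_i.
rewrite -(setD1K iS); apply: PS => [j|].
  rewrite !inE => /andP [nji jS]; rewrite /ext_lt ltn_neqAle min_i // andbT.
  by apply: contra nji => /eqP/ord_inj/enum_rank_inj ->.
by apply: IHn; move: ltS; rewrite (cardsD1 i S) (iS : i \in S).
Qed.

Lemma ext_sign_lt i S : {in S, forall j, ext_lt i j} ->
  ext_sign A [set i] S = 1.
Proof.
move=> ltS; rewrite /ext_sign big_set1 big1 // => j jS.
by rewrite /ext_sign1 ltS.
Qed.

Lemma ext_sign11 i j : ext_sign A [set i] [set j] = ext_sign1 A i j.
Proof. by rewrite /ext_sign !big_set1. Qed.

Lemma ext_signU1 i j S : j \notin S ->
  ext_sign A [set i] (j |: S) = ext_sign1 A i j * ext_sign A [set i] S.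
Proof. by move=> jS; rewrite ext_signUr ?disjoints1 // ext_sign11. Qed.

Lemma ext_sign_in i S : i \in S -> ext_sign A [set i] S = 0.
Proof. by move=> iS; apply: ext_sign_meet iS; rewrite inE. Qed.

Lemma ext_sign_sq i S : i \notin S ->
  ext_sign A [set i] S * ext_sign A [set i] S = 1.
Proof.
move=> iS; rewrite /ext_sign big_set1 -big_split /= big1 // => j jS.
by rewrite ext_sign1_sq //; apply: contraNneq iS => ->.
Qed.

Lemma ext_genM i u S :
  (ext_gen A i * u) S =
    if i \in S then ext_sign A [set i] (S :\ i) * u (S :\ i) else 0.
Proof.
rewrite extM (bigD1 [set i]) //= [X in _ + X]big1 ?addr0; last first.
  by move=> U nU; rewrite big1 // => V _; rewrite ffunE (negPf nU) mulr0 mul0r.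
case: ifPn => iS; last first.
  rewrite big1 // => V /eqP eV; move: iS.
  by rewrite -eV !inE eqxx.
rewrite (bigD1 (S :\ i)) ?setD1K //= big1 ?addr0.
  by rewrite ffunE eqxx mulr1.
move=> V /andP [/eqP eV nV]; rewrite ext_sign_in ?mul0r //.
apply: contraR nV => iV; apply/eqP/setP => j; rewrite -eV !inE.
by case: eqP => //= ->; rewrite (negPf iV).
Qed.

Lemma ext_constD : {morph @ext_const A I : a b / a + b}.
Proof.
by move=> a b; apply/ffunP => S; rewrite !ffunE; case: ifP; rewrite ?addr0.
Qed.

Lemma ext_const1 : ext_const I 1 = 1 :> exterior A I.
Proof. by []. Qed.

Lemma ext_constM a b : ext_const I (a * b) = ext_const I a * ext_const I b.
Proof.
by apply/ffunP => S; rewrite extconstMl !ffunE; case: ifP; rewrite ?mulr0.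
Qed.

Lemma ext_const0 : ext_const I (0 : A) = 0.
Proof. by apply/ffunP => S; rewrite !ffunE if_same. Qed.

Lemma ext_constN1 u : ext_const I (-1) * u = - u.
Proof. by apply/ffunP => S; rewrite extconstMl !ffunE mulN1r. Qed.

Lemma ext_gen_sq i : ext_gen A i * ext_gen A i = 0.
Proof.
apply/ffunP => S; rewrite ext_genM !ffunE; case: ifP => // iS.
case: eqP => [e|_]; last by rewrite mulr0.
have : i \in S :\ i by rewrite e inE.
by rewrite !inE eqxx.
Qed.

Lemma ext_oppE u S : (- u) S = - u S.
Proof. by rewrite ffunE. Qed.

Lemma ext_genC i j : ext_gen A i * ext_gen A j = - (ext_gen A j * ext_gen A i).
Proof.
have [->|nij] := eqVneq i j; first by rewrite ext_gen_sq oppr0.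
have eqS (x y : I) (S : {set I}) : x != y ->
    (x \in S) && (S :\ x == [set y]) = (S == [set x; y]).
  move=> nxy; apply/andP/eqP => [[xS /eqP e]|->]; first by rewrite -(setD1K xS) e.
  rewrite !inE eqxx; split => //; apply/eqP/setP => z; rewrite !inE.
  by case: (z =P x) => //= ->; rewrite (negPf nxy).
apply/ffunP => S; rewrite ext_oppE !ext_genM !ffunE.
have e1 := eqS i j S nij.
have e2 : (j \in S) && (S :\ j == [set i]) = (S == [set i; j]).
  by rewrite setUC eqS // eq_sym.
have {e1} -> : (if i \in S then ext_sign A [set i] (S :\ i) * (S :\ i == [set j])%:R
    else 0) = if S == [set i; j] then ext_sign1 A i j else 0.
  rewrite -e1; case: ifP => //= _; case: eqP => [->|_]; last by rewrite mulr0.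
  by rewrite mulr1 ext_sign11.
have -> : (if j \in S then ext_sign A [set j] (S :\ j) * (S :\ j == [set i])%:R
    else 0) = if S == [set i; j] then ext_sign1 A j i else 0.
  rewrite -e2; case: ifP => //= _; case: eqP => [->|_]; last by rewrite mulr0.
  by rewrite mulr1 ext_sign11.
by case: ifP => _; rewrite ?oppr0 // -ext_sign1N.
Qed.

Lemma ext_monomial_insert (R : nzRingType) (c : {rmorphism A -> R}) (x : I -> R) i S :
  (forall a r, c a * r = r * c a) ->
  (forall j, x j * x j = 0) ->
  (forall j l, x j * x l = - (x l * x j)) ->
  x i * ext_monomial x S = c (ext_sign A [set i] S) * ext_monomial x (i |: S).
Proof.
move=> cC xx xC; move: S; apply: ext_set_ind => [|j S ltS IH].
  by rewrite ext_sign0r rmorph1 mul1r (ext_monomialU1 x (S := set0)) // => j; rewrite inE.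
rewrite (ext_monomialU1 _ ltS).
have jS : j \notin S by apply/negP => /ltS; rewrite ext_lt_irr.
have [eij|nij] := eqVneq i j.
  by rewrite eij mulrA xx mul0r ext_sign_in ?rmorph0 ?mul0r // !inE eqxx.
rewrite ext_signU1 //.
have [ltij|] := boolP (ext_lt i j).
  have ltiS : {in j |: S, forall l, ext_lt i l}.
    move=> l; rewrite !inE => /orP [/eqP -> //|/ltS]; exact: ext_lt_trans.
  rewrite (ext_monomialU1 _ ltiS) (ext_monomialU1 _ ltS).
  rewrite ext_sign_lt => [|l lS]; last by apply: ltiS; rewrite inE lS orbT.
  by rewrite /ext_sign1 ltij mulr1 rmorph1 mul1r.
move=> nlt; have ltji : ext_lt j i.
  rewrite /ext_lt ltn_neqAle leqNgt nlt andbT.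
  by apply: contra nij => /eqP/ord_inj/enum_rank_inj ->.
rewrite /ext_sign1 (negPf nlt) ltji mulN1r rmorphN mulNr.
have -> : i |: (j |: S) = j |: (i |: S) by rewrite setUCA.
rewrite ext_monomialU1; last by move=> l; rewrite !inE => /orP [/eqP -> //|/ltS].
by rewrite mulrA xC mulNr -mulrA IH !mulrA -cC.
Qed.

Lemma ext_monomial_gen S T :
  ext_monomial (ext_gen A) S T = (T == S)%:R.
Proof.
move: S T; apply: ext_set_ind => [|j S ltS IH] T.
  by rewrite ext_monomial0 /GRing.one /= ffunE; case: eqP.
rewrite ext_monomialU1 // ext_genM IH.
have jS : j \notin S by apply/negP => /ltS; rewrite ext_lt_irr.
case: ifPn => jT.
  case: eqP => [e|ne].
    by rewrite e ext_sign_lt // mulr1 -e setD1K // eqxx.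
  case: eqP => [e|_]; last by rewrite mulr0.
  by case: ne; rewrite e setU1K.
by case: eqP => // e; rewrite e !inE eqxx in jT.
Qed.

Lemma ext_basisE u :
  u = \sum_S ext_const I (u S) * ext_monomial (ext_gen A) S.
Proof.
apply/ffunP => T; rewrite sum_ffunE (bigD1 T) //= big1 ?addr0.
  by rewrite extconstMl ext_monomial_gen eqxx mulr1.
move=> S nST; rewrite extconstMl ext_monomial_gen eq_sym (negPf nST).
by rewrite mulr0.
Qed.

Lemma ext_ind (P : exterior A I -> Prop) :
  P 1 -> (forall u v, P u -> P v -> P (u + v)) ->
  (forall a u, P u -> P (ext_const I a * u)) ->
  (forall i u, P u -> P (ext_gen A i * u)) ->
  forall u, P u.
Proof.
move=> P1 PD Pc Pg u; rewrite [u]ext_basisE.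
have P0 : P 0 by rewrite -(mul0r (1 : exterior A I)) -ext_const0; apply: Pc.
apply: (big_ind P) => // S _; apply: Pc.
move: S; apply: ext_set_ind => [|i S ltS IH]; first by rewrite ext_monomial0.
by rewrite ext_monomialU1 //; apply: Pg.
Qed.

End ExteriorBasis.

Section KoszulDifferential.
Variables (A : comNzRingType) (I : finType) (f : I -> A).
Implicit Types (i j : I) (S T : {set I}) (u v w : exterior A I) (a : A).

(* The unique A-linear graded derivation with e_i |-> f i: see
   [koszul_diffC], [koszul_diff_gen] and [koszul_diffM]. *)
Definition koszul_diff u : exterior A I :=
  [ffun S => \sum_i ext_sign A [set i] S * f i * u (i |: S)].

Definition ext_bar u : exterior A I := [ffun S : {set I} => (-1) ^+ #|S| * u S].

Local Notation d := koszul_diff.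
Local Notation bar := ext_bar.

Lemma koszul_diffD : {morph d : u v / u + v}.
Proof.
move=> u v; apply/ffunP => S; rewrite !ffunE -big_split /=.
by apply: eq_bigr => i _; rewrite ffunE mulrDr.
Qed.

Lemma koszul_diff0 : d 0 = 0.
Proof.
by apply/ffunP => S; rewrite !ffunE big1 // => i _; rewrite ffunE mulr0.
Qed.

Lemma koszul_diffC a u : d (ext_const I a * u) = ext_const I a * d u.
Proof.
apply/ffunP => S; rewrite extconstMl !ffunE mulr_sumr.
by apply: eq_bigr => i _; rewrite extconstMl mulrCA.
Qed.

Lemma koszul_diffN : {morph d : u / - u}.
Proof. by move=> u; rewrite -ext_constN1 koszul_diffC ext_constN1. Qed.

Lemma koszul_diff1 : d 1 = 0.
Proof.
apply/ffunP => S; rewrite !ffunE big1 // => i _.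
rewrite /GRing.one /= ffunE; case: eqP => [e|]; last by rewrite mulr0.
by have := setU11 i S; rewrite e inE.
Qed.

Lemma koszul_diff_genM i u :
  d (ext_gen A i * u) = ext_const I (f i) * u - ext_gen A i * d u.
Proof.
apply/ffunP => S; rewrite [LHS]ffunE [RHS]ffunE extconstMl ext_oppE ext_genM.
under eq_bigr => l _ do rewrite ext_genM.
rewrite (bigD1 i) //= !inE eqxx /=.
case: ifPn => iS; last first.
  rewrite setU1K // big1 ?addr0; last first.
    move=> l nli; rewrite !inE (negPf iS) eq_sym (negPf nli) /=.
    by rewrite mulr0.
  by rewrite oppr0 addr0 mulrACA ext_sign_sq // mul1r.
rewrite ext_sign_in // !mul0r add0r ffunE [X in _ = _ - _ * X](bigD1 i) //= setD1K //.
rewrite mulrDr opprD addrA -mulrA [X in _ = _ - X + _]mulrA.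
rewrite ext_sign_sq ?inE ?eqxx // mul1r subrr add0r mulr_sumr -sumrN.
apply: eq_bigr => l nli; rewrite !inE iS orbT.
have nil : i != l by rewrite eq_sym.
have eD : (l |: S) :\ i = l |: (S :\ i).
  by apply/setP => x; rewrite !inE; case: (x =P l) => //= ->; rewrite nli.
have [lS|nlS] := boolP (l \in S).
  have lD : l \in S :\ i by rewrite !inE nli.
  by rewrite (ext_sign_in _ lS) (ext_sign_in _ lD) !mul0r mulr0 oppr0.
have -> : ext_sign A [set l] S = - ext_sign1 A i l * ext_sign A [set l] (S :\ i).
  by rewrite -{1}(setD1K iS) ext_signU1 ?inE ?eqxx // (ext_sign1N A i l).
rewrite eD ext_signU1 ?inE ?(negPf nlS) ?andbF // !mulNr; congr (- _).
rewrite -!mulrA mulrCA [RHS]mulrCA; congr (_ * _).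
rewrite mulrCA [RHS]mulrCA; congr (_ * _).
by rewrite !mulrA ext_sign1_sq // mul1r.
Qed.

Lemma ext_barD : {morph bar : u v / u + v}.
Proof. by move=> u v; apply/ffunP => S; rewrite !ffunE mulrDr. Qed.

Lemma ext_barC a u : bar (ext_const I a * u) = ext_const I a * bar u.
Proof. by apply/ffunP => S; rewrite [LHS]ffunE !extconstMl ffunE mulrCA. Qed.

Lemma ext_barN : {morph bar : u / - u}.
Proof. by move=> u; rewrite -ext_constN1 ext_barC ext_constN1. Qed.

Lemma ext_bar1 : bar 1 = 1.
Proof.
apply/ffunP => S; rewrite !ffunE; case: eqP => [->|]; last by rewrite mulr0.
by rewrite cards0 mul1r.
Qed.

Lemma ext_bar_genM i u : bar (ext_gen A i * u) = - (ext_gen A i * bar u).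
Proof.
apply/ffunP => S; rewrite ext_oppE ext_genM [LHS]ffunE ext_genM ffunE.
case: ifP => iS; last by rewrite mulr0 oppr0.
by rewrite (cardsD1 i S) iS exprS mulN1r mulNr mulrCA.
Qed.

Lemma ext_barM u v : bar (u * v) = bar u * bar v.
Proof.
move: u; apply: ext_ind => [|u w IHu IHw|a u IHu|i u IHu].
- by rewrite ext_bar1 !mul1r.
- by rewrite mulrDl !ext_barD IHu IHw mulrDl.
- by rewrite -mulrA !ext_barC IHu mulrA.
- by rewrite -mulrA !ext_bar_genM IHu mulNr mulrA.
Qed.

Lemma koszul_diffM u v : d (u * v) = d u * v + bar u * d v.
Proof.
move: u; apply: ext_ind => [|u w IHu IHw|a u IHu|i u IHu].
- by rewrite koszul_diff1 ext_bar1 !mul1r mul0r add0r.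
- by rewrite mulrDl !koszul_diffD IHu IHw ext_barD !mulrDl addrACA.
- by rewrite -mulrA !koszul_diffC IHu ext_barC mulrDr !mulrA.
- rewrite -mulrA !koszul_diff_genM IHu ext_bar_genM mulrDr mulrBl mulNr opprD.
  by rewrite addrA !mulrA.
Qed.

Lemma koszul_diff_gen i : d (ext_gen A i) = ext_const I (f i).
Proof.
by rewrite -[ext_gen A i]mulr1 koszul_diff_genM koszul_diff1 mulr0 subr0 mulr1.
Qed.

Lemma koszul_diffK u : d (d u) = 0.
Proof.
move: u; apply: ext_ind => [|u w IHu IHw|a u IHu|i u IHu].
- by rewrite koszul_diff1 koszul_diff0.
- by rewrite !koszul_diffD IHu IHw addr0.
- by rewrite !koszul_diffC IHu mulr0.
- rewrite koszul_diff_genM koszul_diffD koszul_diffC koszul_diffN.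
  by rewrite koszul_diff_genM IHu mulr0 subr0 subrr.
Qed.

Lemma koszul_diff_bar u : d (bar u) = - bar (d u).
Proof.
move: u; apply: ext_ind => [|u w IHu IHw|a u IHu|i u IHu].
- rewrite ext_bar1 koszul_diff1.
  by apply/ffunP => S; rewrite !ffunE mulr0 oppr0.
- by rewrite ext_barD !koszul_diffD ext_barD IHu IHw opprD.
- by rewrite ext_barC !koszul_diffC IHu ext_barC mulrN.
- rewrite ext_bar_genM koszul_diffN !koszul_diff_genM IHu ext_barD ext_barC.
  by rewrite ext_barN ext_bar_genM mulrN opprK opprD.
Qed.

Lemma ext_barK u : bar (bar u) = u.
Proof.
apply/ffunP => S; rewrite !ffunE mulrA -expr2 sqrr_sign mul1r //.
Qed.

End KoszulDifferential.

Section KoszulHomology.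
Variables (k : comNzRingType) (A : comAlgType k) (I : finType) (f : I -> A).

HB.instance Definition _ :=
  GRing.Lmodule.copy (exterior A I) {ffun {set I} -> A}.

Implicit Types (c : k) (u v w : exterior A I).

Lemma ext_scaleE c u : c *: u = ext_const I c%:A * u.
Proof.
by apply/ffunP => S; rewrite extconstMl ffunE -scalerAl mul1r.
Qed.

Lemma ext_scaleAl c u v : c *: (u * v) = (c *: u) * v.
Proof. by rewrite !ext_scaleE mulrA. Qed.

Lemma ext_scaleAr c u v : c *: (u * v) = u * (c *: v).
Proof. by rewrite !ext_scaleE mulrA ext_constC mulrA. Qed.

HB.instance Definition _ :=
  GRing.Lmodule_isLalgebra.Build k (exterior A I) ext_scaleAl.
HB.instance Definition _ :=
  GRing.Lalgebra_isAlgebra.Build k (exterior A I) ext_scaleAr.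

Definition koszul_cycle : {pred exterior A I} := fun u => koszul_diff f u == 0.

Lemma koszul_cycleP u : reflect (koszul_diff f u = 0) (u \in koszul_cycle).
Proof. exact: eqP. Qed.

Lemma koszul_cycle_subalg : GRing.subalg_closed koszul_cycle.
Proof.
split=> [|c u v /koszul_cycleP du /koszul_cycleP dv|u v /koszul_cycleP du /koszul_cycleP dv].
- by apply/koszul_cycleP; exact: koszul_diff1.
- apply/koszul_cycleP.
  by rewrite koszul_diffD ext_scaleE koszul_diffC du dv mulr0 addr0.
- by apply/koszul_cycleP; rewrite koszul_diffM du dv mul0r mulr0 addr0.
Qed.

HB.instance Definition _ := GRing.isSubalgClosed.Build k (exterior A I)
  koszul_cycle koszul_cycle_subalg.

Record koszul_cycles := KoszulCycle {
  koszul_cycle_val :> exterior A I;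
  _ : koszul_cycle_val \in koszul_cycle
}.

HB.instance Definition _ := [isSub for koszul_cycle_val].
HB.instance Definition _ := [Choice of koszul_cycles by <:].
HB.instance Definition _ := [SubChoice_isSubAlgebra of koszul_cycles by <:].

Definition koszul_boundary : {pred koszul_cycles} :=
  fun z => `[< exists w, val z = koszul_diff f w >].

Lemma koszul_boundaryP (z : koszul_cycles) :
  reflect (exists w, val z = koszul_diff f w) (z \in koszul_boundary).
Proof. exact: asboolP. Qed.

Lemma koszul_boundary_zmod : zmod_closed koszul_boundary.
Proof.
split; first by apply/koszul_boundaryP; exists 0; rewrite koszul_diff0 raddf0.
move=> y z /koszul_boundaryP [v ev] /koszul_boundaryP [w ew].
apply/koszul_boundaryP; exists (v - w).
by rewrite koszul_diffD koszul_diffN raddfB /= -ev -ew.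
Qed.

HB.instance Definition _ := GRing.isZmodClosed.Build koszul_cycles
  koszul_boundary koszul_boundary_zmod.

Lemma koszul_boundaryMl (y z : koszul_cycles) :
  z \in koszul_boundary -> y * z \in koszul_boundary.
Proof.
case/koszul_boundaryP => w ew; apply/koszul_boundaryP.
exists (ext_bar (val y) * w).
have /koszul_cycleP dy := valP y.
rewrite koszul_diffM koszul_diff_bar dy ext_barK -ew rmorphM.
have -> : ext_bar (0 : exterior A I) = 0.
  by apply/ffunP => S; rewrite !ffunE mulr0.
by rewrite oppr0 mul0r add0r.
Qed.

Lemma koszul_boundaryMr (y z : koszul_cycles) :
  y \in koszul_boundary -> y * z \in koszul_boundary.
Proof.
case/koszul_boundaryP => w ew; apply/koszul_boundaryP.
exists (w * val z); have /koszul_cycleP dz := valP z.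
by rewrite koszul_diffM dz mulr0 addr0 -ew rmorphM.
Qed.

Lemma koszul_boundaryZ c (z : koszul_cycles) :
  z \in koszul_boundary -> c *: z \in koszul_boundary.
Proof. by move=> zB; rewrite -mulr_algl; apply: koszul_boundaryMl. Qed.

(* Total homology Ker d / Im d, with all homological degrees together. *)
Definition koszul_homology := Quotient.quot koszul_boundary.

HB.instance Definition _ := GRing.Zmodule.on koszul_homology.

Definition koszul_class (z : koszul_cycles) : koszul_homology :=
  \pi_(koszul_homology)%qT z.

Lemma koszul_classP (x : koszul_homology) : exists z, x = koszul_class z.
Proof. by exists (repr x); rewrite /koszul_class reprK. Qed.

Lemma koszul_class_eq (y z : koszul_cycles) :
  koszul_class y = koszul_class z <-> y - z \in koszul_boundary.
Proof.
rewrite Quotient.idealrBE; split; first by move=> e; apply/eqP.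
by move/eqP.
Qed.

Lemma koszul_classB : {morph koszul_class : y z / y - z}.
Proof. by move=> y z; exact: (raddfB (\pi_(Quotient.quot koszul_boundary)%qT)). Qed.

Lemma koszul_classD : {morph koszul_class : y z / y + z}.
Proof. by move=> y z; exact: (raddfD (\pi_(Quotient.quot koszul_boundary)%qT)). Qed.

Definition koszul_homology_mul (x y : koszul_homology) : koszul_homology :=
  koszul_class (repr x * repr y).

Definition koszul_homology_scale c (x : koszul_homology) : koszul_homology :=
  koszul_class (c *: repr x).

Lemma koszul_class_repr (z : koszul_cycles) :
  repr (koszul_class z) - z \in koszul_boundary.
Proof. by apply/koszul_class_eq; rewrite /koszul_class reprK. Qed.

Lemma koszul_class_mul y z :
  koszul_homology_mul (koszul_class y) (koszul_class z) = koszul_class (y * z).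
Proof.
apply/koszul_class_eq.
set y' := repr _; set z' := repr _.
have -> : y' * z' - y * z = (y' - y) * z' + y * (z' - z).
  by rewrite mulrBl mulrBr addrA subrK.
apply: rpredD; first by apply: koszul_boundaryMr; exact: koszul_class_repr.
by apply: koszul_boundaryMl; exact: koszul_class_repr.
Qed.

Lemma koszul_class_scale c z :
  koszul_homology_scale c (koszul_class z) = koszul_class (c *: z).
Proof.
by apply/koszul_class_eq; rewrite -scalerBr koszul_boundaryZ ?koszul_class_repr.
Qed.

Let hmulA : associative koszul_homology_mul.
Proof.
move=> x y z; case: (koszul_classP x) => x' ->; case: (koszul_classP y) => y' ->.
by case: (koszul_classP z) => z' ->; rewrite !koszul_class_mul mulrA.
Qed.

Let hmul1 : left_id (koszul_class 1) koszul_homology_mul.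
Proof. by move=> x; case: (koszul_classP x) => x' ->; rewrite koszul_class_mul mul1r. Qed.

Let hmul1r : right_id (koszul_class 1) koszul_homology_mul.
Proof. by move=> x; case: (koszul_classP x) => x' ->; rewrite koszul_class_mul mulr1. Qed.

Let hmulDl : left_distributive koszul_homology_mul +%R.
Proof.
move=> x y z; case: (koszul_classP x) => x' ->; case: (koszul_classP y) => y' ->.
case: (koszul_classP z) => z' ->.
by rewrite -koszul_classD !koszul_class_mul -koszul_classD mulrDl.
Qed.

Let hmulDr : right_distributive koszul_homology_mul +%R.
Proof.
move=> x y z; case: (koszul_classP x) => x' ->; case: (koszul_classP y) => y' ->.
case: (koszul_classP z) => z' ->.
by rewrite -koszul_classD !koszul_class_mul -koszul_classD mulrDr.
Qed.

HB.instance Definition _ := GRing.Zmodule_isPzRing.Build koszul_homology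
  hmulA hmul1 hmul1r hmulDl hmulDr.

Lemma koszul_classM : {morph koszul_class : y z / y * z}.
Proof. by move=> y z; rewrite -koszul_class_mul. Qed.

Let hscaleA a b (x : koszul_homology) :
  koszul_homology_scale a (koszul_homology_scale b x) =
  koszul_homology_scale (a * b) x.
Proof. by case: (koszul_classP x) => z ->; rewrite !koszul_class_scale scalerA. Qed.

Let hscale1 : left_id 1 koszul_homology_scale.
Proof.
by move=> x; case: (koszul_classP x) => z ->; rewrite !koszul_class_scale scale1r.
Qed.

Let hscaleDr : right_distributive koszul_homology_scale +%R.
Proof.
move=> c x y; case: (koszul_classP x) => x' ->; case: (koszul_classP y) => y' ->.
by rewrite -koszul_classD !koszul_class_scale -koszul_classD scalerDr.
Qed.

Let hscaleDl (x : koszul_homology) :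
  {morph koszul_homology_scale^~ x : a b / a + b}.
Proof.
move=> a b; case: (koszul_classP x) => z ->.
by rewrite !koszul_class_scale -koszul_classD scalerDl.
Qed.

HB.instance Definition _ := GRing.Zmodule_isLmodule.Build k koszul_homology
  hscaleA hscale1 hscaleDr hscaleDl.

Lemma koszul_classZ c z : koszul_class (c *: z) = c *: koszul_class z.
Proof. by rewrite -koszul_class_scale. Qed.

Lemma koszul_homology_scaleAl c (x y : koszul_homology) :
  c *: (x * y) = (c *: x) * y.
Proof.
case: (koszul_classP x) => x' ->; case: (koszul_classP y) => y' ->.
by rewrite -koszul_classM -!koszul_classZ -koszul_classM scalerAl.
Qed.

Lemma koszul_homology_scaleAr c (x y : koszul_homology) :
  c *: (x * y) = x * (c *: y).
Proof.
case: (koszul_classP x) => x' ->; case: (koszul_classP y) => y' ->.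
by rewrite -koszul_classM -!koszul_classZ -koszul_classM scalerAr.
Qed.

Lemma koszul_homology_neq0 (e : {rmorphism A -> k}) :
  (forall i, e (f i) = 0) -> (1 : koszul_homology) != 0.
Proof.
move=> ef0; apply/eqP => e1.
have : koszul_class 1 = koszul_class 0.
  by rewrite -[in RHS](subrr 1) koszul_classB subrr; exact: e1.
move/koszul_class_eq; rewrite subr0 => /koszul_boundaryP [w].
move=> /(congr1 (fun u : exterior A I => e (u set0))) /eqP.
rewrite !ffunE eqxx rmorph1 rmorph_sum big1 ?oner_eq0 // => i _.
by rewrite !rmorphM ef0 mulr0 mul0r.
Qed.

End KoszulHomology.

Section ExteriorConst.
Variables (A : comNzRingType) (I : finType).

Fact ext_const_zmod : zmod_morphism (@ext_const A I).
Proof.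
move=> a b; rewrite ext_constD; congr (_ + _).
by rewrite -mulN1r ext_constM ext_constN1.
Qed.

Fact ext_const_monoid : monoid_morphism (@ext_const A I).
Proof. by split=> // a b; exact: ext_constM. Qed.

HB.instance Definition _ :=
  GRing.isZmodMorphism.Build A (exterior A I) (@ext_const A I) ext_const_zmod.
HB.instance Definition _ :=
  GRing.isMonoidMorphism.Build A (exterior A I) (@ext_const A I) ext_const_monoid.

End ExteriorConst.

Section KoszulMap.
Variables (A B : comNzRingType) (I J : finType).
Variables (phi : {rmorphism A -> B}) (iota : I -> J).
Implicit Types (i : I) (S : {set I}) (u v w : exterior A I) (a : A).

(* The ring morphism extending phi with e_i |-> e_(iota i): see [koszul_mapC],
   [koszul_map_gen] and [koszul_mapM]. *)
Definition koszul_map u : exterior B J :=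
  \sum_S ext_const J (phi (u S)) * ext_monomial (fun i => ext_gen B (iota i)) S.

Local Notation M := (ext_monomial (fun i => ext_gen B (iota i))).

Lemma koszul_mapD : {morph koszul_map : u v / u + v}.
Proof.
move=> u v; rewrite /koszul_map -big_split /=; apply: eq_bigr => S _.
by rewrite ffunE rmorphD ext_constD mulrDl.
Qed.

Lemma koszul_mapC a u :
  koszul_map (ext_const I a * u) = ext_const J (phi a) * koszul_map u.
Proof.
rewrite /koszul_map mulr_sumr; apply: eq_bigr => S _.
by rewrite extconstMl rmorphM ext_constM mulrA.
Qed.

Lemma koszul_mapN : {morph koszul_map : u / - u}.
Proof.
by move=> u; rewrite -(ext_constN1 u) koszul_mapC rmorphN1 ext_constN1.
Qed.

Lemma koszul_map1 : koszul_map 1 = 1.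
Proof.
rewrite /koszul_map (bigD1 set0) //= big1 ?addr0.
  by rewrite /GRing.one /= ffunE eqxx rmorph1 ext_monomial0 mulr1.
move=> S /negPf S0.
by rewrite /GRing.one /= ffunE S0 rmorph0 ext_const0 mul0r.
Qed.

Lemma koszul_map_genM i u :
  koszul_map (ext_gen A i * u) = ext_gen B (iota i) * koszul_map u.
Proof.
pose c : {rmorphism A -> exterior B J} := @ext_const B J \o phi.
rewrite /koszul_map mulr_sumr.
rewrite (bigID (fun S : {set I} => i \in S)) /= [X in _ + X]big1 ?addr0; last first.
  by move=> S iS; rewrite ext_genM (negPf iS) rmorph0 ext_const0 mul0r.
rewrite [RHS](bigID (fun S : {set I} => i \in S)) /=.
rewrite [X in _ = X + _]big1 ?add0r; last first.
  move=> S iS; rewrite mulrA -ext_constC -mulrA.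
  rewrite (@ext_monomial_insert A I (exterior B J) c) //.
  - by rewrite ext_sign_in // rmorph0 mul0r mulr0.
  - by move=> a r; exact: ext_constC.
  - by move=> j; exact: ext_gen_sq.
  - by move=> j l; exact: ext_genC.
rewrite (reindex_onto (fun S => i |: S) (fun S => S :\ i)) /=; last first.
  by move=> S iS; rewrite setD1K.
apply: eq_big => [S|S].
  rewrite setU11 /=; apply/eqP/idP => [e|]; last exact: setU1K.
  by rewrite -e !inE eqxx.
move=> iS; rewrite mulrA -ext_constC -mulrA.
have {}iS : i \notin S.
  by case/andP: iS => _ /eqP e; rewrite -e !inE eqxx.
rewrite (@ext_monomial_insert A I (exterior B J) c); first last.
- by move=> j l; exact: ext_genC.
- by move=> j; exact: ext_gen_sq.
- by move=> a r; exact: ext_constC.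
rewrite ext_genM setU11 setU1K // mulrA; congr (_ * _).
by rewrite /c /= rmorphM ext_constM ext_constC.
Qed.

Lemma koszul_mapM u v : koszul_map (u * v) = koszul_map u * koszul_map v.
Proof.
move: u; apply: ext_ind => [|u w IHu IHw|a u IHu|i u IHu].
- by rewrite koszul_map1 !mul1r.
- by rewrite mulrDl !koszul_mapD IHu IHw mulrDl.
- by rewrite -mulrA !koszul_mapC IHu mulrA.
- by rewrite -mulrA !koszul_map_genM IHu mulrA.
Qed.

Lemma koszul_map_gen i : koszul_map (ext_gen A i) = ext_gen B (iota i).
Proof. by rewrite -[ext_gen A i]mulr1 koszul_map_genM koszul_map1 mulr1. Qed.

Lemma koszul_map_diff (f : I -> A) (g : J -> B) :
  (forall i, phi (f i) = g (iota i)) ->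
  forall u, koszul_diff g (koszul_map u) = koszul_map (koszul_diff f u).
Proof.
move=> fg; have map0 : koszul_map 0 = 0.
  by rewrite /koszul_map big1 // => S _; rewrite ffunE rmorph0 ext_const0 mul0r.
apply: ext_ind => [|u w IHu IHw|a u IHu|i u IHu].
- by rewrite koszul_map1 !koszul_diff1 map0.
- by rewrite koszul_diffD !koszul_mapD koszul_diffD IHu IHw.
- by rewrite koszul_diffC !koszul_mapC koszul_diffC IHu.
rewrite koszul_map_genM !koszul_diff_genM koszul_mapD koszul_mapC fg IHu.
by rewrite -(ext_constN1 (_ * koszul_diff f u)) koszul_mapC rmorphN1 ext_constN1 koszul_map_genM.
Qed.

End KoszulMap.

Section KoszulHomologyMap.
Variables (k : comNzRingType) (A B : comAlgType k) (I J : finType).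
Variables (phi : {rmorphism A -> B}) (iota : I -> J) (f : I -> A) (g : J -> B).
Variable fg : forall i, phi (f i) = g (iota i).

Lemma koszul_map_cycle_subproof (z : koszul_cycles f) :
  koszul_map phi iota (val z) \in koszul_cycle g.
Proof.
apply/koszul_cycleP; have /koszul_cycleP dz := valP z.
rewrite (koszul_map_diff fg) dz.
by rewrite /koszul_map big1 // => S _; rewrite ffunE rmorph0 ext_const0 mul0r.
Qed.

Definition koszul_cycles_map (z : koszul_cycles f) : koszul_cycles g :=
  KoszulCycle (koszul_map_cycle_subproof z).

Definition koszul_homology_map (x : koszul_homology f) : koszul_homology g :=
  koszul_class (koszul_cycles_map (repr x)).

Lemma koszul_homology_mapE z :
  koszul_homology_map (koszul_class z) = koszul_class (koszul_cycles_map z).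
Proof.
apply/koszul_class_eq/koszul_boundaryP.
have /koszul_boundaryP [w ew] := koszul_class_repr z.
exists (koszul_map phi iota w).
by rewrite (koszul_map_diff fg) -ew !raddfB /= koszul_mapD koszul_mapN.
Qed.

End KoszulHomologyMap.

Record sgraph := SGraph {
  vertex :> finType;
  adj : rel vertex;
  adj_sym : ssrbool.symmetric adj;
  adj_irrefl : irreflexive adj
}.

(* Edges are the unordered pairs [set x; y] of adjacent vertices. *)
Definition is_edge (G : sgraph) : pred {set G} :=
  fun e => [exists x : G, exists y : G, adj x y && (e == [set x; y])].

Definition edge (G : sgraph) : finType := {e : {set G} | is_edge e}.

Record subgraph (G : sgraph) := Subgraph {
  sub_vertices : {set G};
  sub_adj : rel G;
  sub_adj_sym : ssrbool.symmetric sub_adj;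
  sub_adjP : forall x y,
    sub_adj x y -> [&& x \in sub_vertices, y \in sub_vertices & adj x y]
}.

Section SubgraphGraph.
Variables (G : sgraph) (H : subgraph G).

Definition sub_vertex : finType := {x : G | x \in sub_vertices H}.

Definition sub_graph_adj : rel sub_vertex := fun x y => sub_adj H (val x) (val y).

Fact sub_graph_adj_sym : ssrbool.symmetric sub_graph_adj.
Proof. by move=> x y; exact: sub_adj_sym. Qed.

Fact sub_graph_adj_irrefl : irreflexive sub_graph_adj.
Proof.
by move=> x; apply/negP => /sub_adjP /and3P [_ _]; rewrite adj_irrefl.
Qed.

Definition sub_graph : sgraph := SGraph sub_graph_adj_sym sub_graph_adj_irrefl.

End SubgraphGraph.

Coercion sub_graph : subgraph >-> sgraph.

Section DeleteEdge.
Variables (G : sgraph) (a b : G).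

Definition del_edge_adj : rel G :=
  fun x y => adj x y && ([set x; y] != [set a; b]).

Fact del_edge_adj_sym : ssrbool.symmetric del_edge_adj.
Proof. by move=> x y; rewrite /del_edge_adj adj_sym setUC. Qed.

Fact del_edge_adj_irrefl : irreflexive del_edge_adj.
Proof. by move=> x; rewrite /del_edge_adj adj_irrefl. Qed.

Definition del_edge : sgraph := SGraph del_edge_adj_sym del_edge_adj_irrefl.

End DeleteEdge.

Section GraphKoszul.
Variables (k : fieldType) (G : sgraph).

Definition graph_poly : comAlgType k := {mpoly k[#|G|]}.

Definition graph_var (x : G) : graph_poly := 'X_(enum_rank x).

Definition edge_poly (e : edge G) : graph_poly :=
  \prod_(x in val e) graph_var x.

Definition koszul_complex : algType k := exterior graph_poly (edge G).

Definition koszul_d : koszul_complex -> koszul_complex := koszul_diff edge_poly.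

Definition graph_cycles : algType k := koszul_cycles edge_poly.

Definition graph_homology : Type := koszul_homology edge_poly.

HB.instance Definition _ := GRing.PzRing.on graph_homology.
HB.instance Definition _ := GRing.Lmodule.on graph_homology.

Lemma edge_polyE (e : edge G) :
  exists x y : G, [/\ adj x y, val e = [set x; y] &
                     edge_poly e = graph_var x * graph_var y].
Proof.
have /existsP [x /existsP [y /andP [xy /eqP ee]]] := valP e.
exists x, y; split=> //; rewrite /edge_poly ee big_setU1 ?big_set1 //=.
by rewrite inE; apply/negP => /eqP exy; rewrite exy adj_irrefl in xy.
Qed.

Fact graph_homology_neq0 : (1 : graph_homology) != 0.
Proof.
apply: (@koszul_homology_neq0 _ _ _ _ (meval (fun=> 0))) => e.
by have [x [y [_ _ ->]]] := edge_polyE e; rewrite rmorphM /= mevalXU mul0r.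
Qed.

HB.instance Definition _ :=
  GRing.PzSemiRing_isNonZero.Build graph_homology graph_homology_neq0.
HB.instance Definition _ := GRing.Lmodule_isLalgebra.Build k graph_homology
  (@koszul_homology_scaleAl _ _ _ edge_poly).
HB.instance Definition _ := GRing.Lalgebra_isAlgebra.Build k graph_homology
  (@koszul_homology_scaleAr _ _ _ edge_poly).

Definition homology_class (z : graph_cycles) : graph_homology :=
  koszul_class z.

End GraphKoszul.

Section SubgraphMap.
Variables (k : fieldType) (G : sgraph) (H : subgraph G).

Definition sub_poly : {rmorphism graph_poly k H -> graph_poly k G} :=
  mmap (@mpolyC #|G| k) (fun i : 'I_#|sub_vertex H| => graph_var k (val (enum_val i))).

Fact sub_edge_subproof (e : edge H) : is_edge [set val x | x in val e].
Proof.
have /existsP [x /existsP [y /andP [xy /eqP ->]]] := valP e.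
apply/existsP; exists (val x); apply/existsP; exists (val y).
have /and3P [_ _ ->] := sub_adjP xy.
by rewrite imsetU1 imset_set1 eqxx.
Qed.

Definition sub_edge (e : edge H) : edge G := Sub _ (sub_edge_subproof e).

Lemma sub_poly_var (x : H) : sub_poly (graph_var k x) = graph_var k (val x).
Proof. by rewrite /sub_poly /graph_var /= mmapX mmap1U enum_rankK. Qed.

Lemma sub_poly_edge (e : edge H) :
  sub_poly (edge_poly k e) = edge_poly k (sub_edge e).
Proof.
rewrite /edge_poly rmorph_prod /= big_imset /=; last by move=> x y _ _ /val_inj.
by apply: eq_bigr => x _; exact: sub_poly_var.
Qed.

Definition sub_homology_map : graph_homology k H -> graph_homology k G :=
  koszul_homology_map sub_poly_edge.

End SubgraphMap.

Section Star.
Variables (k : fieldType) (G : sgraph).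
Implicit Types (x y : G) (ys : seq G).

(* 0 when x and y are not adjacent. *)
Definition edge_gen x y : koszul_complex k G :=
  if insub [set x; y] is Some e then ext_gen _ e else 0.

(* Monomials not divisible by the variable x are dropped; on multiples of x this
   is the exact quotient, see [graph_var_div] and [star_chainE]. *)
Definition div_var x (p : graph_poly k G) : graph_poly k G :=
  \sum_(m <- msupp p | (0 < m (enum_rank x))%N)
     p@_m *: 'X_[(m - U_(enum_rank x))%MM].

Lemma graph_var_div x p : div_var x (graph_var k x * p) = p.
Proof.
rewrite /div_var /graph_var mulrC (perm_big _ (msuppMX p U_(enum_rank x)%MM)) /=.
rewrite big_map big_mkcond /= [RHS]mpolyE; apply: eq_bigr => m _.
by rewrite mnmDE mnm1E eqxx add1n /= mcoeffMX addmC addmK.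
Qed.

Definition star_numerator x ys : koszul_complex k G :=
  koszul_d (\prod_(y <- ys) edge_gen x y).

Definition star_chain x ys : koszul_complex k G :=
  [ffun S : {set edge G} => div_var x (star_numerator x ys S)].

Let vx x : koszul_complex k G := ext_const (edge G) (graph_var k x).

Lemma edge_gen_diff x y :
  koszul_d (edge_gen x y) =
    if adj x y then ext_const (edge G) (graph_var k x * graph_var k y) else 0.
Proof.
rewrite /edge_gen /koszul_d; case: insubP => [e He ee|]; last first.
  rewrite koszul_diff0; case: ifP => // xy /negP []; apply/existsP; exists x.
  by apply/existsP; exists y; rewrite xy eqxx.
have xy : adj x y.
  have /existsP [x' /existsP [y' /andP [xy' /eqP e']]] := He.
  have hx : x' \in [set x; y] by rewrite e' set21.
  have hy : y' \in [set x; y] by rewrite e' set22.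
  move: xy'; case/set2P: hx => ->; case/set2P: hy => -> //.
  - by rewrite adj_irrefl.
  - by rewrite adj_sym.
  - by rewrite adj_irrefl.
rewrite xy koszul_diff_gen /edge_poly ee big_setU1 ?big_set1 //=.
by rewrite inE; apply/negP => /eqP exy; rewrite exy adj_irrefl in xy.
Qed.

Lemma star_numerator_div x ys :
  exists w, star_numerator x ys = vx x * w.
Proof.
rewrite /star_numerator /koszul_d; elim: ys => [|y ys [w IH]].
  by exists 0; rewrite big_nil koszul_diff1 mulr0.
rewrite big_cons.
have := edge_gen_diff x y; rewrite /koszul_d.
have bar_gen : ext_bar (edge_gen x y) = - edge_gen x y.
  rewrite /edge_gen; case: insub => [e|].
    by rewrite -[ext_gen _ e]mulr1 ext_bar_genM ext_bar1.
  by apply/ffunP => S; rewrite !ffunE mulr0 oppr0.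
rewrite koszul_diffM => ->; rewrite IH bar_gen.
exists ((if adj x y then ext_const (edge G) (graph_var k y) else 0) *
         \prod_(y <- ys) edge_gen x y - edge_gen x y * w).
rewrite mulrBr mulNr; congr (_ - _).
  by case: ifP => _; [rewrite ext_constM mulrA | rewrite !mul0r mulr0].
by rewrite !mulrA /vx ext_constC.
Qed.

Lemma star_chainE x ys : vx x * star_chain x ys = star_numerator x ys.
Proof.
have [w ew] := star_numerator_div x ys.
apply/ffunP => S; rewrite /vx extconstMl [in LHS]ffunE ew /vx !extconstMl.
by rewrite graph_var_div.
Qed.

Lemma star_chain_cycle x ys : star_chain x ys \in koszul_cycle (@edge_poly k G).
Proof.
apply/koszul_cycleP; apply/ffunP => S.
have : vx x * koszul_diff (@edge_poly k G) (star_chain x ys) = 0.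
  by rewrite /vx -koszul_diffC star_chainE koszul_diffK.
have zS : (0 : exterior (graph_poly k G) (edge G)) S = 0 by rewrite ffunE.
move/ffunP/(_ S); rewrite /vx extconstMl => e0.
rewrite zS -(graph_var_div x (koszul_diff _ _ S)) e0 -[LHS]/(div_var x ((0 : exterior (graph_poly k G) (edge G)) S)) zS.
by rewrite /div_var msupp0 big_nil.
Qed.

Definition star x ys : graph_homology k G :=
  homology_class (KoszulCycle (star_chain_cycle x ys)).

End Star.

(* X generates R as a unital k-algebra. *)
Definition generates_algebra (k : nzRingType) (R : algType k) (X : R -> Prop) : Prop :=
  forall S : {pred R}, GRing.subalg_closed S ->
    (forall r, X r -> r \in S) -> forall r, r \in S.

(* Main.v *)
(* Write K_a, K_b for the Koszul complexes of the two sides and e for the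
   generator of the bridge ab, so that a chain is u + e v with u, v in the span
   K_a K_b of the products p q, and it is a cycle iff dv = 0 and du = - ab v.
   A k-linear h with d h d = d turns pi = 1 - h d - d h into a projection onto
   cycles which is homotopic to the identity, and pi (x) pi annihilates the
   boundaries of K_a K_b. Hence v may be taken to be a sum of products of cycles
   killed by f (x) g, where f = pi a pi and g = pi b pi; pseudo-inverses of f and
   g split v into terms p q with a p or b q a boundary. If a p = dr, then
   (e p - b r) q is a cycle with the e-part of p q, and subtracting all of these
   leaves a cycle in K_a K_b, homologous to a sum of products of cycles.

   It remains to treat e p - b r with a p = dr in K_a. Modulo a, the complex K_a
   is the exterior algebra on the edges at a over the complex of the remaining
   graph, so r = sum_I w_I e_I + a t with cycles w_I. Then e p - b r equals
   - sum_I w_I (1/a) d(e e_I) - d(e t), a combination of stars at a. *)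
Require Import Defs.
From HB Require Import structures.
From mathcomp Require Import all_boot all_order all_algebra.
From mathcomp Require Import boolp.
From mathcomp Require classical_sets.
From mathcomp.multinomials Require Import mpoly.

Set Implicit Arguments.
Unset Strict Implicit.
Unset Printing Implicit Defensive.

Import GRing.Theory.
Local Open Scope ring_scope.

(** * Complements and pseudo-inverses of linear maps *)

Section LinearAlgebra.
Variables (k : fieldType) (V : lmodType k).
Implicit Types (U W : V -> Prop) (f g : V -> V) (c : k).

Definition subspace U := U 0 /\ forall c u v, U u -> U v -> U (c *: u + v).

Lemma subspaceD U u v : subspace U -> U u -> U v -> U (u + v).
Proof. by case=> _ sU Uu Uv; rewrite -[u]scale1r; apply: sU. Qed.

Lemma subspaceZ U c u : subspace U -> U u -> U (c *: u).
Proof. by case=> U0 sU Uu; rewrite -[_ *: _]addr0; apply: sU. Qed.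

Lemma subspaceB U u v : subspace U -> U u -> U v -> U (u - v).
Proof.
move=> sU Uu Uv; rewrite -scaleN1r; apply: subspaceD => //.
exact: subspaceZ.
Qed.

(** Zorn's lemma provides a maximal subspace [W] meeting [U] only in 0. A vector outside [U + W]
    could be adjoined to it, against maximality. *)
Lemma subspace_complement U : subspace U ->
  exists W, [/\ subspace W, forall v, U v -> W v -> v = 0 &
    forall v, exists u w, [/\ U u, W w & v = u + w]].
Proof.
move=> sU.
pose T := {W : V -> Prop | subspace W /\ forall v, U v -> W v -> v = 0}.
pose R (s t : T) := `[< forall v, sval s v -> sval t v >].
have ext (s t : T) : (forall v, sval s v <-> sval t v) -> s = t.
  case: s t => [s ps] [t pt] /= st.
  have est : s = t by apply/funext => v; apply/propext.
  by subst t; congr exist; apply: Prop_irrelevance.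
have [||||[W [sW UW]] maxW] := @classical_sets.Zorn T R.
- by move=> t; apply/asboolP.
- by move=> r s t /asboolP rs /asboolP st; apply/asboolP => v /rs /st.
- by move=> s t /asboolP st /asboolP ts; apply: ext => v; split; [apply: st|apply: ts].
- move=> C totC.
  (* The union of the chain; the disjunct [v = 0] makes the empty chain give the zero subspace. *)
  pose W v := v = 0 \/ exists2 s, C s & sval s v.
  have sW : subspace W.
    split=> [|c u v]; first by left.
    case=> [->|[s Cs su]]; case=> [->|[t Ct tv]].
    - by left; rewrite scaler0 addr0.
    - by right; exists t => //; rewrite scaler0 add0r.
    - by right; exists s => //; rewrite addr0; apply: subspaceZ (proj1 (svalP s)) _.
    - right; case: (totC s t Cs Ct) => /asboolP H.
      + by exists t => //; apply: (proj2 (proj1 (svalP t))) => //; apply: H.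
      + by exists s => //; apply: (proj2 (proj1 (svalP s))) => //; apply: H.
  have UW v : U v -> W v -> v = 0.
    by move=> Uv [//|[s _ sv]]; exact: (proj2 (svalP s)).
  exists (exist _ W (conj sW UW)) => s Cs; apply/asboolP => v sv /=.
  by right; exists s.
exists W; split=> // v.
have [[u [w [Uu Ww ->]]]|nv] := pselect (exists u w, [/\ U u, W w & v = u + w]).
  by exists u, w.
pose W' x := exists c w, W w /\ x = c *: v + w.
have sW' : subspace W'.
  split; first by exists 0, 0; rewrite scale0r addr0; split=> //; case: (sW).
  move=> c _ _ [c1 [w1 [Ww1 ->]]] [c2 [w2 [Ww2 ->]]].
  exists (c * c1 + c2), (c *: w1 + w2); split; first exact: (proj2 sW).
  by rewrite scalerDr scalerA scalerDl addrACA.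
have UW' x : U x -> W' x -> x = 0.
  move=> Ux [c [w [Ww ex]]]; have [c0|nc] := eqVneq c 0.
    by apply: (UW _ Ux); rewrite ex c0 scale0r add0r.
  (* With [c] invertible, [v = c^-1 x - c^-1 w] is a decomposition excluded by [nv]. *)
  case: nv; exists (c^-1 *: x), (c^-1 *: (- w)); split.
  - exact: subspaceZ.
  - by apply: (subspaceZ _ sW); rewrite -sub0r; apply: (subspaceB sW) => //; case: (sW).
  - by rewrite -scalerDr ex addrK scalerA mulVf // scale1r.
have eW : exist _ W' (conj sW' UW') = exist _ W (conj sW UW) :> T.
  apply: maxW; apply/asboolP => w /= Ww; exists 0, w.
  by rewrite scale0r add0r.
have Wv : W v.
  have := congr1 (fun t : T => sval t v) eW => /= <-.
  by exists 1, 0; rewrite scale1r addr0; split=> //; case: (sW).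
by exists 0, v; rewrite add0r; split=> //; case: sU.
Qed.

(** With [C] a complement of the kernel and [D] one of the image, [g] vanishes on [D] and inverts
    the restriction of [f] to [C]. *)
Lemma linear_pseudoinverse f : linear f ->
  exists2 g, linear g & forall v, f (g (f v)) = f v.
Proof.
move=> lf.
have f0 : f 0 = 0 by have := lf (-1) 0 0; rewrite scaler0 addr0 scaleN1r addNr.
have fB u v : f (u - v) = f u - f v.
  by rewrite addrC -scaleN1r lf scaleN1r addrC.
have [|C [sC KC KCV]] := @subspace_complement (fun v => f v = 0).
  by split=> // c u v fu fv; rewrite lf fu fv scaler0 addr0.
have [|D [sD ID IDV]] := @subspace_complement (fun v => exists u, v = f u).
  split; first by exists 0.
  by move=> c _ _ [u ->] [v ->]; exists (c *: u + v); rewrite lf.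
have ex y : exists x, C x /\ D (y - f x).
  have [_ [d [[x ->] Dd ->]]] := IDV y.
  have [u [w [fu Cw ->]]] := KCV x.
  exists w; split=> //.
  by rewrite -[u]scale1r lf fu scaler0 add0r addrAC subrr add0r.
have [g Pg] := choice ex.
(* Uniqueness of the point of [C] is what makes the chosen [g] linear. *)
have uniq_g x y : C x -> D (y - f x) -> g y = x.
  move=> Cx Dx; have [Cg Dg] := Pg y; apply/eqP; rewrite -subr_eq0; apply/eqP.
  apply: KC; last exact: subspaceB.
  apply: ID; first by exists (g y - x).
  rewrite fB; have -> : f (g y) - f x = (y - f x) - (y - f (g y)).
    by rewrite opprB [RHS]addrC addrA subrK.
  exact: subspaceB.
exists g => [c u v|v].
  have [Cu Du] := Pg u; have [Cv Dv] := Pg v.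
  apply: uniq_g; first exact: (proj2 sC).
  by rewrite lf opprD addrACA -scalerBr; apply: (proj2 sD).
have [_ Dv] := Pg (f v); apply/eqP; rewrite eq_sym -subr_eq0; apply/eqP.
by apply: ID Dv; exists (v - g (f v)); rewrite fB.
Qed.

End LinearAlgebra.

Lemma linear_zero (k : fieldType) (V W : lmodType k) (f : V -> W) :
  linear f -> f 0 = 0.
Proof. by move=> lf; have := lf (-1) 0 0; rewrite scaler0 addr0 scaleN1r addNr. Qed.

Lemma linearDE (k : fieldType) (V W : lmodType k) (f : V -> W) u v :
  linear f -> f (u + v) = f u + f v.
Proof. by move=> lf; rewrite -[u]scale1r lf !scale1r. Qed.

Lemma linearZE (k : fieldType) (V W : lmodType k) (f : V -> W) c u :
  linear f -> f (c *: u) = c *: f u.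
Proof. by move=> lf; rewrite -[c *: u]addr0 lf linear_zero // addr0. Qed.

Lemma linearBE (k : fieldType) (V W : lmodType k) (f : V -> W) u v :
  linear f -> f (u - v) = f u - f v.
Proof. by move=> lf; rewrite linearDE // -scaleN1r linearZE // scaleN1r. Qed.

Lemma linear_sumE (k : fieldType) (V W : lmodType k) (f : V -> W) (T : Type) (s : seq T) (F : T -> V) :
  linear f -> f (\sum_(x <- s) F x) = \sum_(x <- s) f (F x).
Proof.
move=> lf; elim: s => [|x s IH]; first by rewrite !big_nil linear_zero.
by rewrite !big_cons linearDE // IH.
Qed.

Lemma linearNE (k : fieldType) (V W : lmodType k) (f : V -> W) u : linear f -> f (- u) = - f u.
Proof. by move=> lf; rewrite -scaleN1r linearZE // scaleN1r. Qed.

Lemma linear_comp (k : fieldType) (V1 V2 V3 : lmodType k) (f : V2 -> V3) (g : V1 -> V2) :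
  linear f -> linear g -> linear (fun x => f (g x)).
Proof. by move=> lf lg c u v; rewrite lg lf. Qed.

Lemma linear_sub (k : fieldType) (V W : lmodType k) (f g : V -> W) :
  linear f -> linear g -> linear (fun x => f x - g x).
Proof. by move=> lf lg c u v; rewrite lf lg opprD addrACA -scalerBr. Qed.

Lemma linear_id_map (k : fieldType) (V : lmodType k) : linear (fun x : V => x).
Proof. by []. Qed.

(* With d h d = d, the map pi = 1 - h d - d h is a projection onto
   representatives of the homology, up to homotopy. *)
Lemma homology_projection (k : fieldType) (V : lmodType k) (dV : V -> V) :
  linear dV -> (forall x, dV (dV x) = 0) ->
  exists h pi : V -> V, [/\ linear h, linear pi,
    forall x, pi x = x - h (dV x) - dV (h x),
    forall x, dV (pi x) = 0 & forall x, pi (dV x) = 0].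
Proof.
move=> dl dVK; have [h lh dhd] := linear_pseudoinverse dl.
exists h, (fun x => x - h (dV x) - dV (h x)); split=> // [|x|x].
- apply: linear_sub; last exact: linear_comp.
  by apply: linear_sub => //; exact: linear_comp.
- by rewrite !(linearBE _ _ dl) dhd dVK subrr subr0.
- by rewrite dVK linear_zero // subr0 dhd subrr.
Qed.

(** * Monomial bases of Koszul complexes *)

Section SignedMonomials.
Variables (k : fieldType) (A : comAlgType k) (I : finType).
Implicit Types (i j : I) (S T : {set I}).
Local Notation e := (ext_monomial (ext_gen A)).

(** Each factor is 1 or -1, since 0 would force equal indices. Only the existence of a sign is
    recorded: in [koszul_tensor_lift] it meets itself and squares to 1. *)
Lemma ext_sign_unit i S : i \notin S ->
  exists b : bool, ext_sign A [set i] S = (-1) ^+ b.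
Proof.
move=> iS; rewrite /ext_sign big_set1.
apply: (big_rec (fun x : A => exists b : bool, x = (-1) ^+ b)).
  by exists false.
move=> j _ jS [b ->]; rewrite /ext_sign1.
case: ifP => [_|nij]; first by exists b; rewrite mul1r.
case: ifP => [_|nji]; first by exists (~~ b); rewrite signrN mulN1r.
have := iS; rewrite (_ : i = j) ?jS //; apply/enum_rank_inj/ord_inj/eqP.
by move: nij nji; rewrite /ext_lt; case: ltngtP.
Qed.

Lemma ext_const_signE (b : bool) (u : exterior A I) :
  ext_const I ((-1) ^+ b) * u = (-1) ^+ b *: u :> exterior A I.
Proof. by case: b; rewrite ?ext_constN1 ?scaleN1r ?scale1r // ext_const1 mul1r. Qed.

Lemma ext_gen_monomial i S : i \notin S ->
  exists b : bool, ext_gen A i * e S = (-1) ^+ b *: e (i |: S) :> exterior A I.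
Proof.
move=> iS; have [b eb] := ext_sign_unit iS; exists b.
rewrite (@ext_monomial_insert A I (exterior A I) (@ext_const A I)) /=.
- by rewrite eb ext_const_signE.
- by move=> a r; exact: ext_constC.
- by move=> j; exact: ext_gen_sq.
- by move=> j l; exact: ext_genC.
Qed.

Lemma ext_monomialM S T : [disjoint S & T] ->
  exists b : bool, e S * e T = (-1) ^+ b *: e (S :|: T) :> exterior A I.
Proof.
move: S; apply: ext_set_ind => [|i S ltS IH] dST.
  by exists false; rewrite ext_monomial0 mul1r scale1r set0U.
have iS : i \notin S by apply/negP => /ltS; rewrite ext_lt_irr.
have [|b eb] := IH.
  by apply: disjointWl dST; apply: subsetUr.
have [|b' eb'] := @ext_gen_monomial i (S :|: T).
  rewrite inE (negPf iS) /=; move/pred0P/(_ i): dST.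
  by rewrite /= !inE eqxx /= => ->.
exists (b (+) b'); rewrite ext_monomialU1 // -mulrA eb -ext_scaleAr eb'.
by rewrite scalerA -signr_addb setUA.
Qed.

(** [iota] may disturb the enumeration order, so sorting the product costs a sign. *)
Lemma ext_monomial_map (J : finType) (iota : J -> I) (S : {set J}) :
  injective iota ->
  exists b : bool, ext_monomial (fun x : J => ext_gen A (iota x)) S =
    (-1) ^+ b *: e (iota @: S) :> exterior A I.
Proof.
move=> inj; move: S; apply: ext_set_ind => [|j S ltS [b eb]].
  by exists false; rewrite imset0 !ext_monomial0 scale1r.
have jS : iota j \notin iota @: S.
  by rewrite mem_imset //; apply/negP => /ltS; rewrite ext_lt_irr.
have [b' eb'] := ext_gen_monomial jS.
exists (b (+) b'); rewrite ext_monomialU1 // eb -ext_scaleAr eb'.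
by rewrite scalerA -signr_addb imsetU1.
Qed.

End SignedMonomials.

Section KoszulGeneralities.
Variables (A B : comNzRingType) (I J : finType).
Variables (phi : {rmorphism A -> B}) (iota : I -> J).

(* Polarization of the identity d^2 = 0 for f + g. *)
Lemma koszul_diff_anticomm (f g : I -> A) u :
  koszul_diff f (koszul_diff g u) = - koszul_diff g (koszul_diff f u).
Proof.
have addE v : koszul_diff (fun i => f i + g i) v = koszul_diff f v + koszul_diff g v.
  apply/ffunP => S; rewrite !ffunE -big_split; apply: eq_bigr => i _ /=.
  by rewrite mulrDr mulrDl.
have := koszul_diffK (fun i => f i + g i) u.
rewrite !addE !koszul_diffD !koszul_diffK add0r addr0 => /eqP.
by rewrite addr_eq0 => /eqP.
Qed.

Lemma koszul_map0 : koszul_map phi iota 0 = 0.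
Proof. by rewrite -(subrr 0) koszul_mapD koszul_mapN subrr. Qed.

Lemma ext_bar_map u : ext_bar (koszul_map phi iota u) = koszul_map phi iota (ext_bar u).
Proof.
move: u; apply: ext_ind => [|u w IHu IHw|a u IHu|i u IHu].
- by rewrite ext_bar1 !koszul_map1 ext_bar1.
- by rewrite ext_barD !koszul_mapD ext_barD IHu IHw.
- by rewrite ext_barC !koszul_mapC ext_barC IHu.
- by rewrite ext_bar_genM koszul_mapN !koszul_map_genM ext_bar_genM IHu.
Qed.

Lemma koszul_map_monomial S :
  koszul_map phi iota (ext_monomial (ext_gen A) S) =
    ext_monomial (fun i => ext_gen B (iota i)) S.
Proof.
move: S; apply: ext_set_ind => [|i S ltS IH].
  by rewrite !ext_monomial0 koszul_map1.
by rewrite !ext_monomialU1 // koszul_map_genM IH.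
Qed.

End KoszulGeneralities.

Section MonomialBasis.
Variables (k : fieldType) (n : nat) (I : finType).
Local Notation A := {mpoly k[n]}.
Local Notation K := (exterior A I).

Definition koszul_monomial (m : 'X_{1..n}) (S : {set I}) : K :=
  ext_const I 'X_[m] * ext_monomial (ext_gen A) S.

Lemma koszul_monomial_span (Q : K -> Prop) : subspace Q ->
  (forall m S, Q (koszul_monomial m S)) -> forall u, Q u.
Proof.
move=> sQ Qb u; rewrite [u]ext_basisE.
have Q0 : Q 0 by case: sQ.
apply: (big_ind Q) => // [v w|S _]; first exact: subspaceD.
rewrite [u S]mpolyE raddf_sum mulr_suml.
apply: (big_ind Q) => // [v w|m _]; first exact: subspaceD.
rewrite -[_ *: 'X_[m]]mulr_algl /= ext_constM -mulrA -ext_scaleE.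
exact: (subspaceZ _ sQ (Qb m S)).
Qed.

(** The range of summation depends on [p]. Zero terms extend it to one list containing all three
    supports, where linearity holds term by term. *)
Lemma linear_mcoeff_sum (X : lmodType k) (F : 'X_{1..n} -> X) :
  linear (fun p : A => \sum_(m <- msupp p) p@_m *: F m).
Proof.
have wide (p : A) s : uniq s -> {subset msupp p <= s} ->
    \sum_(m <- msupp p) p@_m *: F m = \sum_(m <- s) p@_m *: F m.
  move=> us ps; rewrite [RHS](bigID (mem (msupp p))) /= [X in _ + X]big1 ?addr0.
    rewrite -[RHS]big_filter; apply: perm_big; apply: uniq_perm.
    - exact: msupp_uniq.
    - exact: filter_uniq.
    - by move=> m; rewrite mem_filter; case: (boolP (m \in msupp p)) => //= /ps ->.
  by move=> m mp; rewrite memN_msupp_eq0 // scale0r.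
move=> c p q; set s := undup (msupp p ++ msupp q ++ msupp (c *: p + q)).
rewrite !(wide _ s) ?undup_uniq //; first last.
- by move=> m mp; rewrite mem_undup !mem_cat mp !orbT.
- by move=> m mp; rewrite mem_undup !mem_cat mp.
- by move=> m mp; rewrite mem_undup !mem_cat mp !orbT.
rewrite scaler_sumr -big_split; apply: eq_bigr => m _ /=.
by rewrite mcoeffD mcoeffZ scalerDl scalerA.
Qed.

(** The coefficients of the polynomials [u S] are coordinates of [u] in the monomials, so values on
    the monomials can be prescribed freely. *)
Lemma koszul_linear_extension (X : lmodType k) (F : 'X_{1..n} -> {set I} -> X) :
  exists2 L : K -> X, linear L & forall m S, L (koszul_monomial m S) = F m S.
Proof.
exists (fun u => \sum_S \sum_(m <- msupp (u S)) (u S)@_m *: F m S).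
  move=> c u v; rewrite scaler_sumr -big_split; apply: eq_bigr => S _ /=.
  by rewrite 2!ffunE; apply: (@linear_mcoeff_sum X (F^~ S)).
move=> m S; rewrite (bigD1 S) //= [X in _ + X]big1 ?addr0 => [|T nTS].
  rewrite /koszul_monomial extconstMl ext_monomial_gen eqxx mulr1 msuppX.
  by rewrite big_seq1 mcoeffX eqxx scale1r.
rewrite /koszul_monomial extconstMl ext_monomial_gen (negPf nTS) mulr0.
by rewrite msupp0 big_nil.
Qed.

End MonomialBasis.

Section VariableEmbedding.
Variables (k : fieldType) (n' n : nat) (I' I : finType).
Local Notation A' := {mpoly k[n']}.
Local Notation A := {mpoly k[n]}.
Variables (phi : {rmorphism A' -> A}) (s : 'I_n' -> 'I_n) (iota : I' -> I).
Hypothesis phiZ : forall c p, phi (c *: p) = c *: phi p.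
Hypothesis phiX : forall i, phi 'X_i = 'X_(s i).
Hypothesis iota_inj : injective iota.

Definition mnm_push (m : 'X_{1..n'}) : 'X_{1..n} := (\sum_i U_(s i) *+ m i)%MM.

Lemma mnm_pushE m i : injective s -> mnm_push m (s i) = m i.
Proof.
move=> inj; rewrite /mnm_push mnm_sumE (bigD1 i) //= mulmnE mnm1E eqxx mul1n.
rewrite big1 ?addn0 // => j nji.
by rewrite mulmnE mnm1E (inj_eq inj) (negPf nji).
Qed.

Lemma mnm_push_out m j : (forall i, s i != j) -> mnm_push m j = 0%N.
Proof.
move=> out; rewrite /mnm_push mnm_sumE big1 // => i _.
by rewrite mulmnE mnm1E (negPf (out i)).
Qed.

Lemma map_mpolyX_push m : phi 'X_[m] = 'X_[mnm_push m].
Proof.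
rewrite mpolyXE_id rmorph_prod /= /mnm_push -mprodXnE.
by apply: eq_bigr => i _; rewrite rmorphXn /= phiX.
Qed.

Lemma koszul_map_linear : linear (koszul_map phi iota : exterior A' I' -> exterior A I).
Proof.
move=> c u v; rewrite koszul_mapD; congr (_ + _).
by rewrite !ext_scaleE koszul_mapC phiZ rmorph1.
Qed.

Lemma koszul_map_koszul_monomial m S :
  exists b : bool, koszul_map phi iota (koszul_monomial k m S) =
    (-1) ^+ b *: koszul_monomial k (mnm_push m) (iota @: S) :> exterior A I.
Proof.
rewrite /koszul_monomial koszul_mapC map_mpolyX_push koszul_map_monomial.
have [b eb] := @ext_monomial_map k A I I' iota S iota_inj.
by exists b; rewrite eb -ext_scaleAr.
Qed.

End VariableEmbedding.

(** Spanning families enter as induction principles over subspaces; bilinearity allows one such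
    induction in each argument. *)
Lemma spanned_bilinear_eq (k : fieldType) (K1 K2 X : lmodType k) (K : algType k)
    (T1 T2 : Type) (b1 : T1 -> K1) (b2 : T2 -> K2) (j1 : K1 -> K) (j2 : K2 -> K)
    (L : K -> X) (B : K1 -> K2 -> X) :
  (forall Q : K1 -> Prop, subspace Q -> (forall x, Q (b1 x)) -> forall u, Q u) ->
  (forall Q : K2 -> Prop, subspace Q -> (forall x, Q (b2 x)) -> forall u, Q u) ->
  linear j1 -> linear j2 -> linear L ->
  (forall p, linear (B p)) -> (forall q, linear (B^~ q)) ->
  (forall x y, L (j1 (b1 x) * j2 (b2 y)) = B (b1 x) (b2 y)) ->
  forall p q, L (j1 p * j2 q) = B p q.
Proof.
move=> span1 span2 lin1 lin2 linL linr linl LE p q; move: p.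
apply: span1 => [|x].
  split=> [|c u v Lu Lv].
    by rewrite (linear_zero lin1) mul0r (linear_zero linL); have := linear_zero (linl q).
  by rewrite lin1 mulrDl -scalerAl linL Lu Lv (linl q).
move: q; apply: span2 => [|y //].
split=> [|c u v Lu Lv].
  by rewrite (linear_zero lin2) mulr0 (linear_zero linL) (linear_zero (linr _)).
by rewrite lin2 mulrDr -scalerAr linL Lu Lv (linr _).
Qed.

Lemma ext_signed_mulACA (k : fieldType) (A : comAlgType k) (I : finType)
    (c1 c2 c3 : bool) (x1 x2 : A) (u1 u2 u : exterior A I) :
  u1 * u2 = (-1) ^+ c3 *: u ->
  ((-1) ^+ c1 *: (ext_const I x1 * u1)) * ((-1) ^+ c2 *: (ext_const I x2 * u2)) =
  (-1) ^+ (c1 (+) c2 (+) c3) *: (ext_const I (x1 * x2) * u) :> exterior A I.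
Proof.
move=> uE; rewrite -ext_scaleAl -ext_scaleAr scalerA -signr_addb.
rewrite -mulrA [u1 * _]mulrA -[u1 * _]ext_constC -mulrA uE.
by rewrite mulrA -ext_constM -ext_scaleAr scalerA -signr_addb.
Qed.

Lemma mcoeff_koszul_monomial (k : fieldType) (n : nat) (I : finType) (c : k) m S :
  ((c *: koszul_monomial k m S : exterior {mpoly k[n]} I) S)@_m = c.
Proof.
rewrite ffunE /koszul_monomial extconstMl ext_monomial_gen eqxx mulr1.
by rewrite mcoeffZ mcoeffX eqxx mulr1.
Qed.

Section TensorLift.
Variables (k : fieldType) (n1 n2 n : nat) (I1 I2 I : finType).
Local Notation A1 := {mpoly k[n1]}.
Local Notation A2 := {mpoly k[n2]}.
Local Notation A := {mpoly k[n]}.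
Variables (phi1 : {rmorphism A1 -> A}) (s1 : 'I_n1 -> 'I_n) (iota1 : I1 -> I).
Variables (phi2 : {rmorphism A2 -> A}) (s2 : 'I_n2 -> 'I_n) (iota2 : I2 -> I).
Hypothesis phi1Z : forall c p, phi1 (c *: p) = c *: phi1 p.
Hypothesis phi2Z : forall c p, phi2 (c *: p) = c *: phi2 p.
Hypothesis phi1X : forall i, phi1 'X_i = 'X_(s1 i).
Hypothesis phi2X : forall i, phi2 'X_i = 'X_(s2 i).
Hypotheses (iota1_inj : injective iota1) (iota2_inj : injective iota2).
Hypotheses (s1_inj : injective s1) (s2_inj : injective s2).
Hypothesis s12 : forall i j, s1 i != s2 j.
Hypothesis iota12 : forall i j, iota1 i != iota2 j.

Local Notation K1 := (exterior A1 I1).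
Local Notation K2 := (exterior A2 I2).
Local Notation K := (exterior A I).
Local Notation j1 := (koszul_map phi1 iota1 : K1 -> K).
Local Notation j2 := (koszul_map phi2 iota2 : K2 -> K).

(* The products of pushed-forward monomials are, up to sign, distinct elements
   of the monomial basis of the big complex. *)
Lemma koszul_tensor_lift (X : lmodType k) (B : K1 -> K2 -> X) :
  (forall p, linear (B p)) -> (forall q, linear (B^~ q)) ->
  exists2 L : K -> X, linear L & forall p q, L (j1 p * j2 q) = B p q.
Proof.
move=> linr linl.
(* These restrictions recover the exponents of both factors from those of the product, because the
   two sides use disjoint variables. *)
pose pull1 (m : 'X_{1..n}) : 'X_{1..n1} := [multinom m (s1 i) | i < n1].
pose pull2 (m : 'X_{1..n}) : 'X_{1..n2} := [multinom m (s2 i) | i < n2].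
pose b1 m (S : {set I}) : K1 := koszul_monomial k (pull1 m) (iota1 @^-1: S).
pose b2 m (S : {set I}) : K2 := koszul_monomial k (pull2 m) (iota2 @^-1: S).
(* The coefficient is the sign with which the basis monomial occurs in the product of its two
   factors. Evaluating [L] on that product brings in the same sign again, and the two cancel. *)
have [L linL LE] := koszul_linear_extension
  (fun m S => ((j1 (b1 m S) * j2 (b2 m S) : K) S)@_m *: B (b1 m S) (b2 m S)).
exists L => //.
apply: (@spanned_bilinear_eq k K1 K2 X K _ _
  (fun x => koszul_monomial k x.1 x.2) (fun x => koszul_monomial k x.1 x.2)) => //.
- by move=> Q sQ Qb; apply: koszul_monomial_span sQ _ => m S; apply: (Qb (m, S)).
- by move=> Q sQ Qb; apply: koszul_monomial_span sQ _ => m S; apply: (Qb (m, S)).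
- exact: koszul_map_linear.
- exact: koszul_map_linear.
move=> [m1 S1] [m2 S2] /=.
have [c1 e1] := koszul_map_koszul_monomial phi1X iota1_inj m1 S1.
have [c2 e2] := koszul_map_koszul_monomial phi2X iota2_inj m2 S2.
set m := (mnm_push s1 m1 + mnm_push s2 m2)%MM.
set S := (iota1 @: S1) :|: (iota2 @: S2).
have dS : [disjoint iota1 @: S1 & iota2 @: S2].
  apply/pred0P => x /=; apply/andP => -[/imsetP [i _ ->] /imsetP [j _ /eqP]].
  by rewrite (negPf (iota12 i j)).
have [c3 e3] := @ext_monomialM k A I _ _ dS.
have [b eb] : exists b : bool,
    j1 (koszul_monomial k m1 S1) * j2 (koszul_monomial k m2 S2) =
    (-1) ^+ b *: koszul_monomial k m S :> K.
  exists (c1 (+) c2 (+) c3); rewrite e1 e2 /koszul_monomial mpolyXD.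
  exact: ext_signed_mulACA e3.
have ep1 : pull1 m = m1.
  apply/mnmP => i; rewrite mnmE /m mnmDE mnm_pushE // mnm_push_out ?addn0 // => j.
  by rewrite eq_sym.
have ep2 : pull2 m = m2.
  by apply/mnmP => i; rewrite mnmE /m mnmDE mnm_pushE // mnm_push_out ?add0n.
have eS1 : iota1 @^-1: S = S1.
  apply/setP => i; rewrite !inE mem_imset //; case: (i \in S1) => //=.
  by apply/imsetP => -[j _ /eqP]; rewrite (negPf (iota12 i j)).
have eS2 : iota2 @^-1: S = S2.
  apply/setP => i; rewrite !inE orbC mem_imset //; case: (i \in S2) => //=.
  by apply/imsetP => -[j _ /eqP]; rewrite eq_sym (negPf (iota12 j i)).
rewrite eb linearZE // LE /b1 /b2 ep1 ep2 eS1 eS2 eb.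
by rewrite mcoeff_koszul_monomial scalerA -signr_addb addbb scale1r.
Qed.

End TensorLift.

(** * Cycles in a complex u + E v over a tensor product of complexes *)

(* Below, m is the multiplication by d E and del the contraction with E. *)
Section TensorCycles.
Variables (k : fieldType) (Ka Kb : lmodType k) (K : algType k).
Variables (ja : Ka -> K) (jb : Kb -> K) (E : K).
Variables (da bara la : Ka -> Ka) (db lb : Kb -> Kb) (d m del : K -> K).
Hypotheses (ja_lin : linear ja) (jb_lin : linear jb).
Hypotheses (da_lin : linear da) (bara_lin : linear bara) (la_lin : linear la).
Hypotheses (db_lin : linear db) (lb_lin : linear lb).
Hypotheses (d_lin : linear d) (m_lin : linear m) (del_lin : linear del).
Hypothesis dK : forall u, d (d u) = 0.
Hypotheses (daK : forall p, da (da p) = 0) (dbK : forall q, db (db q) = 0).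
Hypotheses (baraK : forall p, bara (bara p) = p).
Hypotheses (da_bar : forall p, da (bara p) = - bara (da p)).
Hypotheses (la_bar : forall p, la (bara p) = bara (la p)).
Hypotheses (da_la : forall p, da (la p) = la (da p)).
Hypotheses (db_lb : forall q, db (lb q) = lb (db q)).
Local Notation t p q := (ja p * jb q).
Hypothesis dt : forall p q, d (t p q) = t (da p) q + t (bara p) (db q).
Hypothesis mt : forall p q, m (t p q) = t (la p) (lb q).
Hypothesis dE : forall u, d (E * u) = m u - E * d u.
Hypothesis del_t : forall p q, del (t p q) = 0.
Hypothesis delE : forall u, del (E * u) = u - E * del u.
Hypothesis tensor_map : forall (f : Ka -> Ka) (g : Kb -> Kb), linear f -> linear g ->
  exists2 L : K -> K, linear L & forall p q, L (t p q) = t (f p) (g q).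

(** Plays the role of the tensor product of [Ka] and [Kb] inside [K]; an explicit list of pure
    tensors permits splitting term by term. *)
Definition tensor_sum (u : K) : Prop :=
  exists s : seq (Ka * Kb), u = \sum_(x <- s) t x.1 x.2.

Hypothesis decomposition : forall z, exists u v,
  [/\ tensor_sum u, tensor_sum v & z = u + E * v].

Lemma tensor_sum_ind (P : K -> Prop) :
  P 0 -> (forall u v, P u -> P v -> P (u + v)) -> (forall p q, P (t p q)) ->
  forall u, tensor_sum u -> P u.
Proof. by move=> P0 PD Pt _ [s ->]; apply: (big_ind P). Qed.

Lemma tensor_sum0 : tensor_sum 0.
Proof. by exists [::]; rewrite big_nil. Qed.

Lemma tensor_sumD u v : tensor_sum u -> tensor_sum v -> tensor_sum (u + v).
Proof. by move=> [s ->] [s' ->]; exists (s ++ s'); rewrite big_cat. Qed.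

Lemma tensor_sum1 p q : tensor_sum (t p q).
Proof. by exists [:: (p, q)]; rewrite big_seq1. Qed.

Lemma tensor_sum_image (f : K -> K) : linear f ->
  (forall p q, tensor_sum (f (t p q))) -> forall u, tensor_sum u -> tensor_sum (f u).
Proof.
move=> lf ft; apply: tensor_sum_ind => // [|u v fu fv].
  by rewrite linear_zero //; apply: tensor_sum0.
by rewrite linearDE //; apply: tensor_sumD.
Qed.

Lemma tensor_sum_eq (f g : K -> K) : linear f -> linear g ->
  (forall p q, f (t p q) = g (t p q)) -> forall u, tensor_sum u -> f u = g u.
Proof.
move=> lf lg fg; apply: tensor_sum_ind => // [|u v fu fv].
  by rewrite !linear_zero.
by rewrite !(linearDE _ _ lf) !(linearDE _ _ lg) fu fv.
Qed.

Lemma tensor_sumN u : tensor_sum u -> tensor_sum (- u).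
Proof.
apply: (tensor_sum_image (f := -%R)) => [c x y|p q].
  by rewrite opprD scalerN.
rewrite -mulNr -scaleN1r -(linearZE _ _ ja_lin).
exact: tensor_sum1.
Qed.

Lemma tensor_sum_d u : tensor_sum u -> tensor_sum (d u).
Proof.
apply: tensor_sum_image => // p q.
by rewrite dt; apply: tensor_sumD; exact: tensor_sum1.
Qed.

Lemma tensor_sum_m u : tensor_sum u -> tensor_sum (m u).
Proof. by apply: tensor_sum_image => // p q; rewrite mt; exact: tensor_sum1. Qed.

Lemma tensor_sum_del u : tensor_sum u -> del u = 0.
Proof.
move: u; apply: tensor_sum_ind => // [|u v du dv]; first exact: linear_zero.
by rewrite linearDE // du dv addr0.
Qed.

(** The contraction [del] kills tensor sums and sends [E * v] to [v], so it isolates the second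
    part. *)
Lemma tensor_sum_direct u v : tensor_sum u -> tensor_sum v -> u + E * v = 0 ->
  u = 0 /\ v = 0.
Proof.
move=> tu tv uv; suff v0 : v = 0 by move: uv; rewrite v0 mulr0 addr0.
have := congr1 del uv.
by rewrite linearDE // delE (tensor_sum_del tu) (tensor_sum_del tv) mulr0 subr0 add0r
     linear_zero.
Qed.

(** The last two premises concern cycles whose [E]-part is a product of cycles [x], [y] with [la x]
    or [lb y] a boundary. The [bara] in the second one compensates the sign in the derivation rule
    [dt]. *)
Lemma tensor_cycle_ind (Q : K -> Prop) :
  (forall u v, Q u -> Q v -> Q (u + v)) -> (forall w, Q (d w)) ->
  (forall x y, da x = 0 -> db y = 0 -> Q (t x y)) ->
  (forall x r y, da x = 0 -> la x = da r -> db y = 0 ->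
     Q (E * t x y - t r (lb y))) ->
  (forall x y r, da x = 0 -> db y = 0 -> lb y = db r ->
     Q (E * t x y - t (la (bara x)) r)) ->
  forall z, d z = 0 -> Q z.
Proof.
move=> QD Qd Qxy Qa Qb.
have Q0 : Q 0 by rewrite -(linear_zero d_lin).
have QB u v : Q (u - v) -> Q v -> Q u by move=> /QD H /H; rewrite subrK.
have QN u w : Q (u - d w) -> Q u by move=> Qu; apply: QB Qu _.
have [ha [pia [ha_lin pia_lin piaE da_pi pi_da]]] := homology_projection da_lin daK.
have [hb [pib [hb_lin pib_lin pibE db_pi pi_db]]] := homology_projection db_lin dbK.
have [P P_lin PE] := tensor_map pia_lin pib_lin.
have P_d u : tensor_sum u -> P (d u) = 0.
  move: u; apply: tensor_sum_ind => [|u v Pu Pv|p q].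
  - by rewrite !linear_zero.
  - by rewrite !linearDE // Pu Pv addr0.
  by rewrite dt linearDE // !PE pi_da pi_db (linear_zero ja_lin) (linear_zero jb_lin)
       mul0r mulr0 addr0.
(* The homotopy [hb] acts on the second factor, hence the sign [bara] on the first. *)
have [Hb Hb_lin HbE] := tensor_map bara_lin hb_lin.
have [P1 P1_lin P1E] := tensor_map (@linear_id_map k Ka) pib_lin.
have [Ha Ha_lin HaE] := tensor_map ha_lin (@linear_id_map k Kb).
(* Two homotopies in succession: [Hb] leads from the identity to [P1], then [Ha] from [P1] to
   [P]. *)
have homotopy v : tensor_sum v -> d v = 0 ->
    exists2 w, tensor_sum w & v = d w + P v.
  move=> tv dv.
  have ev : v = d (Hb v) + P1 v.
    have: d (Hb v) + Hb (d v) = v - P1 v.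
      apply: (@tensor_sum_eq (fun v => d (Hb v) + Hb (d v)) (fun v => v - P1 v)) tv.
      - by move=> c x y; rewrite Hb_lin !d_lin Hb_lin addrACA -scalerDr.
      - exact: linear_sub.
      move=> p q; rewrite dt HbE P1E dt (linearDE _ _ Hb_lin) !HbE baraK da_bar pibE.
      rewrite (linearNE _ ja_lin) !(linearBE _ _ jb_lin) mulNr !mulrBr.
      by rewrite addrACA addNr add0r [in RHS]opprB addrCA subKr.
    by rewrite dv (linear_zero Hb_lin) addr0 => ->; rewrite subrK.
  have tP1 : tensor_sum (P1 v).
    by move: v tv {dv ev}; apply: tensor_sum_image => // p q; rewrite P1E; exact: tensor_sum1.
  have dP1 : d (P1 v) = 0.
    by have := congr1 d ev; rewrite linearDE // dK dv add0r.
  have eP1 : P1 v = d (Ha (P1 v)) + P v.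
    have: d (Ha (P1 v)) + Ha (d (P1 v)) = P1 v - P v.
      move: v tv {dv ev tP1 dP1}.
      apply: (@tensor_sum_eq (fun v => d (Ha (P1 v)) + Ha (d (P1 v))) (fun v => P1 v - P v)).
      - move=> c x y; rewrite P1_lin Ha_lin !d_lin Ha_lin addrACA -scalerDr //.
      - exact: linear_sub.
      (* The second factor is now a cycle, so the terms with [bara] drop out. *)
      move=> p q; rewrite P1E HaE PE !dt db_pi (linear_zero jb_lin) !mulr0 !addr0.
      rewrite HaE piaE !(linearBE _ _ ja_lin) !mulrBl.
      by rewrite [in RHS]opprB addrCA subKr addrC.
    by rewrite dP1 (linear_zero Ha_lin) addr0 => ->; rewrite subrK.
  exists (Hb v + Ha (P1 v)); last by rewrite linearDE // -addrA -eP1 -ev.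
  apply: tensor_sumD.
    by apply: tensor_sum_image tv => // p q; rewrite HbE; exact: tensor_sum1.
  by apply: tensor_sum_image tP1 => // p q; rewrite HaE; exact: tensor_sum1.
have Q_P u : tensor_sum u -> Q (P u).
  move: u; apply: tensor_sum_ind => [|u v Pu Pv|p q].
  - by rewrite linear_zero.
  - by rewrite linearDE //; apply: QD.
  - by rewrite PE; apply: Qxy.
have Q_tensor u : tensor_sum u -> d u = 0 -> Q u.
  by move=> tu du; have [w _ ->] := homotopy u tu du; apply: QD => //; apply: Q_P.
move=> z dz; have [u [v [tu tv ez]]] := decomposition z.
(* Here [d z = (d u + m v) - E * d v], and the two parts vanish separately. *)
have [duv dv] : d u + m v = 0 /\ d v = 0.
  have [|||H1 H2] := @tensor_sum_direct (d u + m v) (- d v).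
  - by apply: tensor_sumD; [apply: tensor_sum_d|apply: tensor_sum_m].
  - exact/tensor_sumN/tensor_sum_d.
  - by rewrite mulrN -addrA -dE -linearDE // -ez.
  by split=> //; rewrite -[d v]opprK H2 oppr0.
have [w tw ev] := homotopy v tv dv.
have {}duv : d (u + m w) + m (P v) = 0.
  have dm : d (m w) = m (d w).
    move: w tw {ev}; apply: (@tensor_sum_eq (fun x => d (m x)) (fun x => m (d x))).
    - exact: linear_comp.
    - exact: linear_comp.
    move=> p q; rewrite mt !dt (linearDE _ _ m_lin) !mt da_la db_lb la_bar.
    by [].
  by rewrite (linearDE _ _ d_lin) dm -addrA -(linearDE _ _ m_lin) -ev.
(* Adding the boundary [d (E * w) = m w - E * d w] to [z] replaces [v] by [P v] and [u] by
   [u + m w]. *)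
have: Q ((u + m w) + E * P v); last first.
  move=> H; apply: (QN _ (- (E * w))); move: H; congr Q.
  have eEv : E * v = E * d w + E * P v by rewrite -mulrDr -ev.
  rewrite ez eEv (linearNE _ d_lin) opprK dE -!addrA; congr (_ + _).
  by rewrite addrCA [E * d w + _]addrC subrK addrC.
have tu' : tensor_sum (u + m w) by apply: tensor_sumD => //; apply: tensor_sum_m.
move: (u + m w) tu' duv => {tu ez ev}u tu duv.
(* The maps that [la] and [lb] induce on homology, read on the representatives chosen by [pia] and
   [pib]. *)
pose fa p := pia (la (pia p)); pose fb q := pib (lb (pib q)).
have fa_lin : linear fa by do 2!apply: linear_comp => //.
have fb_lin : linear fb by do 2!apply: linear_comp => //.
have [ga ga_lin fgfa] := linear_pseudoinverse fa_lin.
have [gb gb_lin fgfb] := linear_pseudoinverse fb_lin.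
(* [pia p] is split as [xa p + xa' p], where [xa p] comes from the kernel of [fa]; [yb] is the
   analogous kernel part on the other side. *)
pose xa p := pia (p - ga (fa p)); pose xa' p := pia (ga (fa p)).
pose yb q := pib (q - gb (fb q)).
have [L0 L0_lin L0E] := tensor_map fa_lin fb_lin.
(* On [v] the map [L0] is [P] after [m] after [P]. Since [m (P v) = - d u] is a boundary, [P] kills
   it. *)
have L0v : L0 v = 0.
  have -> : L0 v = P (m (P v)).
    apply: (tensor_sum_eq (g := fun v => P (m (P v)))) tv => //.
      by do 2!apply: linear_comp => //.
    by move=> p q; rewrite L0E PE mt PE.
  have -> : m (P v) = - d u by apply/eqP; rewrite -addr_eq0 addrC duv.
  by rewrite (linearNE _ P_lin) P_d // oppr0.
have Pv_split : forall s, v = \sum_(x <- s) t x.1 x.2 ->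
    P v = \sum_(x <- s) (t (xa x.1) (pib x.2) + t (xa' x.1) (yb x.2)).
  move=> s es.
  have [L1 L1_lin L1E] := tensor_map (linear_comp pia_lin ga_lin) (linear_comp pib_lin gb_lin).
  (* The tensors of [pia (ga (fa p))] with [pib (gb (fb q))] add up to [L1 (L0 v)], hence to 0. Each
     remaining term has a factor [xa] or [yb]. *)
  have -> : P v = P v - L1 (L0 v) by rewrite L0v (linear_zero L1_lin) subr0.
  rewrite es (linear_sumE _ _ P_lin) (linear_sumE _ _ L0_lin) (linear_sumE _ _ L1_lin) -sumrB.
  apply: eq_bigr => x _; rewrite PE L0E L1E /xa /xa' /yb.
  by rewrite !(linearBE _ _ pia_lin) !(linearBE _ _ pib_lin) (linearBE _ _ ja_lin)
     (linearBE _ _ jb_lin) mulrBl mulrBr addrA subrK.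
have [s es] := tv.
have da_xa p : da (xa p) = 0 by rewrite /xa da_pi.
have da_xa' p : da (xa' p) = 0 by rewrite /xa' da_pi.
have db_yb q : db (yb q) = 0 by rewrite /yb db_pi.
(* [la (xa p)] is a cycle that [pia] annihilates, so [piaE] exhibits it as a boundary. *)
have la_xa p : la (xa p) = da (ha (la (xa p))).
  have := piaE (la (xa p)); rewrite da_la da_xa (linear_zero la_lin) (linear_zero ha_lin).
  rewrite subr0; have -> : pia (la (xa p)) = fa p - fa (ga (fa p)).
    by rewrite -(linearBE _ _ fa_lin).
  by rewrite fgfa subrr => /esym/eqP; rewrite subr_eq0 => /eqP.
have lb_yb q : lb (yb q) = db (hb (lb (yb q))).
  have := pibE (lb (yb q)); rewrite db_lb db_yb (linear_zero lb_lin) (linear_zero hb_lin).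
  rewrite subr0; have -> : pib (lb (yb q)) = fb q - fb (gb (fb q)).
    by rewrite -(linearBE _ _ fb_lin).
  by rewrite fgfb subrr => /esym/eqP; rewrite subr_eq0 => /eqP.
(* The correction terms of the last two premises, with [r] supplied by [ha] and [hb]. *)
pose T1 p q := t (ha (la (xa p))) (lb (pib q)).
pose T2 p q := t (la (bara (xa' p))) (hb (lb (yb q))).
pose tau := \sum_(x <- s) (T1 x.1 x.2 + T2 x.1 x.2).
have CE : E * P v - tau = \sum_(x <- s)
    ((E * t (xa x.1) (pib x.2) - T1 x.1 x.2) + (E * t (xa' x.1) (yb x.2) - T2 x.1 x.2)).
  rewrite (Pv_split s es) mulr_sumr -sumrB; apply: eq_bigr => x _.
  by rewrite mulrDr opprD addrACA.
have t_tau : tensor_sum tau.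
  rewrite /tau; apply: (big_ind tensor_sum) => [||x _].
  - exact: tensor_sum0.
  - exact: tensor_sumD.
  - by apply: tensor_sumD; exact: tensor_sum1.
have dPv : d (P v) = 0.
  move: v tv {dv duv L0v Pv_split es CE}; apply: tensor_sum_ind => [|v v' dv' dv''|p q].
  - by rewrite !linear_zero.
  - by rewrite !linearDE // dv' dv'' addr0.
  by rewrite PE dt da_pi db_pi (linear_zero ja_lin) (linear_zero jb_lin) mul0r mulr0 addr0.
have dT1 p q : d (T1 p q) = m (t (xa p) (pib q)).
  rewrite dt mt -la_xa db_lb db_pi (linear_zero lb_lin) (linear_zero jb_lin).
  by rewrite mulr0 addr0.
have dT2 p q : d (T2 p q) = m (t (xa' p) (yb q)).
  rewrite dt mt -lb_yb -la_bar baraK da_la da_bar da_xa' (linear_zero bara_lin) oppr0.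
  by rewrite (linear_zero la_lin) (linear_zero ja_lin) mul0r add0r.
have dtau : d tau = m (P v).
  rewrite (Pv_split s es) /tau (linear_sumE _ _ d_lin) (linear_sumE _ _ m_lin).
  by apply: eq_bigr => x _; rewrite (linearDE _ _ d_lin) (linearDE _ _ m_lin) dT1 dT2.
(* [u + tau] is a cycle without [E]-part, and [E * P v - tau] is a sum of corrected cycles. *)
rewrite -[u](addrK tau) -addrA [- tau + _]addrC CE; apply: (QD).
  by apply: Q_tensor; [exact: tensor_sumD | rewrite (linearDE _ _ d_lin) dtau].
apply: (big_ind Q) => [//||x _]; first exact: QD.
by apply: (QD); [exact: Qa | exact: Qb].
Qed.

End TensorCycles.

(** * Stars *)

Section StarSpan.
Variables (A : comNzRingType) (I : finType) (f : I -> A) (c : A) (N : pred I).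
Variable psi : {rmorphism A -> A}.
Hypothesis psi_c : psi c = 0.
Hypothesis psi_div : forall p, exists q, p = psi p + c * q.
Hypothesis psi_f : forall i, ~~ N i -> psi (f i) = f i.
Hypothesis f_div : forall i, N i -> exists q, f i = c * q.

Local Notation K := (exterior A I).
Local Notation d := (koszul_diff f).
Local Notation C := (ext_const I c).
Local Notation del i := (koszul_diff (fun j : I => (j == i)%:R : A)).

Lemma ext_gen_bar i (u : K) : ext_gen A i * u = ext_bar u * ext_gen A i.
Proof.
move: u; apply: ext_ind => [|u w IHu IHw|a u IHu|j u IHu].
- by rewrite ext_bar1 mul1r mulr1.
- by rewrite ext_barD mulrDl mulrDr IHu IHw.
- by rewrite ext_barC mulrA -ext_constC -!mulrA IHu.
- by rewrite mulrA ext_genC mulNr -mulrA IHu ext_bar_genM mulNr mulrA.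
Qed.

Lemma koszul_diff_bar_cycle (u : K) : d u = 0 -> d (ext_bar u) = 0.
Proof.
move=> du; rewrite koszul_diff_bar du; apply/ffunP => S.
by rewrite !ffunE mulr0 oppr0.
Qed.

(** At a vertex, [c] is its variable, [psi] sets this variable to 0 and [N] selects the incident
    edges. For chains of these shapes the comparison with stars is explicit. *)
Inductive star_span : K -> Prop :=
| star_span_mul t : star_span (C * t)
| star_span_prod w L : d w = 0 -> uniq L -> all N L ->
    star_span (w * \prod_(i <- L) ext_gen A i)
| star_span_add u v : star_span u -> star_span v -> star_span (u + v).

(** The list [L0] bounds the generators that may appear in the products, for an induction removing
    them one at a time. *)
Inductive star_span_in (L0 : seq I) : K -> Prop :=
| star_span_in_mul t : star_span_in L0 (C * t)
| star_span_in_prod w L : d w = 0 -> uniq L -> {subset L <= L0} ->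
    star_span_in L0 (w * \prod_(i <- L) ext_gen A i)
| star_span_in_add u v : star_span_in L0 u -> star_span_in L0 v ->
    star_span_in L0 (u + v).

Lemma star_span_in_weaken i L0 u : star_span_in L0 u -> star_span_in (i :: L0) u.
Proof.
elim=> [t|w L dw uL sL|v w _ IHv _ IHw].
- exact: star_span_in_mul.
- by apply: star_span_in_prod => // j /sL; rewrite inE orbC => ->.
- exact: star_span_in_add.
Qed.

(** Moving the generator past a cycle [w] turns [w] into [ext_bar w], which is again a cycle. *)
Lemma star_span_in_gen i L0 u : i \notin L0 ->
  star_span_in L0 u -> star_span_in (i :: L0) (ext_gen A i * u).
Proof.
move=> iL; elim=> [t|w L dw uL sL|v w _ IHv _ IHw].
- by rewrite mulrA -ext_constC -mulrA; apply: star_span_in_mul.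
- rewrite mulrA ext_gen_bar -mulrA.
  have := @star_span_in_prod (i :: L0) (ext_bar w) (i :: L).
  rewrite big_cons; apply.
  + exact: koszul_diff_bar_cycle.
  + by rewrite /= uL andbT; apply: contra iL => /sL.
  + by move=> j; rewrite !inE => /orP [->//|/sL ->]; rewrite orbT.
- by rewrite mulrDr; apply: star_span_in_add.
Qed.

(** Keeping the sign covers the case [i \in S] as well, where the sign is 0. *)
Lemma del_zeroE i (r : K) S : del i r = 0 -> ext_sign A [set i] S * r (i |: S) = 0.
Proof.
move=> dr; have <- : del i r S = 0 by rewrite dr ffunE.
rewrite ffunE (bigD1 i) //= eqxx mulr1 big1 ?addr0 // => j nji.
by rewrite (negPf nji) mulr0 mul0r.
Qed.

Local Notation Psi := (koszul_map psi (fun i : I => i)).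

Lemma koszul_map_idE (r : K) S : Psi r S = psi (r S).
Proof.
rewrite /koszul_map sum_ffunE (bigD1 S) //= extconstMl ext_monomial_gen eqxx mulr1.
by rewrite big1 ?addr0 // => T nTS; rewrite extconstMl ext_monomial_gen eq_sym
  (negPf nTS) mulr0.
Qed.

(** Setting [c] to 0 in [r] gives a cycle for the differential of [psi \o f]. This agrees with [f]
    on the generators occurring in [r], so the result is a cycle for [f]; the remainder is a
    multiple of [c]. *)
Lemma star_span_in_nil (r x : K) :
  (forall i, N i -> del i r = 0) -> d r = C * x -> star_span_in [::] r.
Proof.
move=> dNr dr.
have [q qE] := choice psi_div.
have -> : r = Psi r + C * ([ffun S => q (r S)] : K).
  apply/ffunP => S; rewrite [LHS]qE [RHS]ffunE extconstMl koszul_map_idE.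
  by rewrite ffunE.
apply: star_span_in_add; last exact: star_span_in_mul.
rewrite -[Psi r]mulr1 -(big_nil 1 (@GRing.mul _) xpredT (ext_gen A)).
apply: star_span_in_prod => //.
have <- : koszul_diff (fun i => psi (f i)) (Psi r) = 0.
  rewrite (@koszul_map_diff _ _ _ _ psi (fun i => i) f) // dr koszul_mapC psi_c.
  by rewrite ext_const0 mul0r.
apply/ffunP => S; rewrite !ffunE; apply: eq_bigr => i _.
have [Ni|nNi] := boolP (N i); last by rewrite psi_f.
have dPsi : del i (Psi r) = 0.
  rewrite (@koszul_map_diff _ _ _ _ psi (fun i => i) (fun j => (j == i)%:R)).
    by rewrite dNr // koszul_map0.
  by move=> j; rewrite rmorph_nat.
by rewrite ![ext_sign _ _ _ * _]mulrC -!mulrA del_zeroE // !mulr0.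
Qed.

(** Write [r = r1 + e_i r2] with [r2] the contraction of [r] by [e_i]. Both parts are free of [e_i],
    and their boundaries are again divisible by [c], since [f i] is and contractions anticommute
    with [d]. The cofactor [x] changes, so it is quantified in the induction. *)
Lemma star_span_in_all L0 : uniq L0 -> all N L0 -> forall r x : K,
  (forall i, N i -> i \notin L0 -> del i r = 0) -> d r = C * x ->
  star_span_in L0 r.
Proof.
elim: L0 => [_ _|i L0 IH /= /andP [iL uL] /andP [Ni NL]] r x dNr dr.
  by apply: star_span_in_nil dr => i Ni; apply: dNr.
pose r2 := del i r; pose r1 := r - ext_gen A i * r2.
have dr2 : d r2 = C * - del i x.
  by rewrite koszul_diff_anticomm dr koszul_diffC mulrN.
have [g fE] := f_div Ni.
have dr1 : d r1 = C * (x - ext_const I g * r2 - ext_gen A i * del i x).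
  rewrite koszul_diffD koszul_diffN dr koszul_diff_genM dr2 fE ext_constM !mulrBr.
  have -> : ext_gen A i * (C * - del i x) = - (C * (ext_gen A i * del i x)).
    by rewrite !mulrN mulrA -ext_constC mulrA.
  by rewrite opprK opprD addrA !mulrA.
rewrite -[r](subrK (ext_gen A i * r2)) -/r1.
apply: star_span_in_add.
  apply: star_span_in_weaken; apply: (IH uL NL _ _ _ dr1) => j Nj jL.
  have [->|nji] := eqVneq j i.
    by rewrite koszul_diffD koszul_diffN koszul_diff_genM eqxx mul1r koszul_diffK
      mulr0 subr0 subrr.
  rewrite koszul_diffD koszul_diffN koszul_diff_genM eq_sym (negPf nji).
  have dj : del j r = 0 by apply: dNr; rewrite // inE negb_or nji.
  by rewrite koszul_diff_anticomm dj koszul_diff0 ext_const0 mul0r oppr0 mulr0 !subr0.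
apply: star_span_in_gen => //; apply: (IH uL NL _ _ _ dr2) => j Nj jL.
have [->|nji] := eqVneq j i; first exact: koszul_diffK.
have dj : del j r = 0 by apply: dNr; rewrite // inE negb_or nji.
by rewrite koszul_diff_anticomm dj koszul_diff0 oppr0.
Qed.

Lemma star_spanP (r x : K) : d r = C * x -> star_span r.
Proof.
move=> dr; have : star_span_in (enum N) r.
  apply: star_span_in_all dr; first exact: enum_uniq.
    by apply/allP => i; rewrite mem_enum.
  by move=> i Ni; rewrite mem_enum => /negP; case.
elim=> [t|w L dw uL sL|u v _ Hu _ Hv].
- exact: star_span_mul.
- by apply: star_span_prod => //; apply/allP => i /sL; rewrite mem_enum.
- exact: star_span_add.
Qed.

End StarSpan.

Lemma mpoly_ring_ind (R : nzRingType) (n : nat) (P : {mpoly R[n]} -> Prop) :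
  (forall c, P c%:MP) -> (forall i, P 'X_i) ->
  (forall p q, P p -> P q -> P (p + q)) -> (forall p q, P p -> P q -> P (p * q)) ->
  forall p, P p.
Proof.
move=> PC PX PD PM; apply: mpolyind => [|c m p _ _ Pp]; first by rewrite -mpolyC0.
apply: PD => //; rewrite -mul_mpolyC; apply: (PM) => //.
rewrite mpolyXE_id; apply: (big_ind P) => // [|i _]; first by rewrite -mpolyC1.
by elim: (m i) => [|e IH]; rewrite ?expr0 -?mpolyC1 // exprS; apply: (PM).
Qed.

Section KoszulLinear.
Variables (k : comNzRingType) (A : comAlgType k) (I : finType).
Local Notation K := (exterior A I).

Lemma koszul_diff_linear (f : I -> A) : linear (koszul_diff f : K -> K).
Proof. by move=> c u v; rewrite koszul_diffD !ext_scaleE koszul_diffC. Qed.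

Lemma ext_bar_linear : linear (@ext_bar A I : K -> K).
Proof. by move=> c u v; rewrite ext_barD !ext_scaleE ext_barC. Qed.

Lemma ext_const_mul_linear (p : A) : linear (fun u : K => ext_const I p * u).
Proof. by move=> c u v; rewrite mulrDr ext_scaleAr. Qed.

End KoszulLinear.

(** * Edges and stars under the embedding of a subgraph *)

Section GraphEdges.
Variables (k : fieldType) (G : sgraph).

(** Division by the variable, applied to each coefficient, undoes the multiplication. *)
Lemma graph_var_cancel (x : G) (u v : koszul_complex k G) :
  ext_const (edge G) (graph_var k x) * u = ext_const (edge G) (graph_var k x) * v ->
  u = v.
Proof.
move=> /ffunP uv; apply/ffunP => S; have := uv S; rewrite !extconstMl => e.
by rewrite -(graph_var_div x (u S)) e graph_var_div.
Qed.

Lemma edge_genE (x y : G) (e : edge G) : val e = [set x; y] ->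
  edge_gen k x y = ext_gen (graph_poly k G) e.
Proof. by move=> ee; rewrite /edge_gen -ee valK. Qed.

Lemma is_edge_adj (x y : G) : adj x y -> is_edge [set x; y].
Proof. by move=> xy; apply/existsP; exists x; apply/existsP; exists y; rewrite xy eqxx. Qed.

Lemma edge_other_end (x : G) (e : edge G) : x \in val e ->
  exists2 y, adj x y & val e = [set x; y].
Proof.
have [y [z [yz ee _]]] := edge_polyE k e; rewrite ee => /set2P [->|->].
  by exists z.
by exists y; rewrite 1?adj_sym // setUC.
Qed.

Lemma edge_poly_adj (x y : G) (e : edge G) : adj x y -> val e = [set x; y] ->
  edge_poly k e = graph_var k x * graph_var k y.
Proof.
move=> xy ee; rewrite /edge_poly ee big_setU1 ?big_set1 //= inE.
by apply: contraTneq xy => ->; rewrite adj_irrefl.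
Qed.

Lemma koszul_d_edge_gen (x y : G) (u : koszul_complex k G) : adj x y ->
  koszul_d (edge_gen k x y * u) =
    ext_const (edge G) (graph_var k x * graph_var k y) * u - edge_gen k x y * koszul_d u.
Proof.
move=> xy; pose e : edge G := Sub _ (is_edge_adj xy).
rewrite (@edge_genE x y e) // /koszul_d koszul_diff_genM.
by rewrite (edge_poly_adj xy).
Qed.

End GraphEdges.

Section SubgraphStars.
Variables (k : fieldType) (G : sgraph) (H : subgraph G).
Local Notation K := (koszul_complex k G).
Local Notation KH := (koszul_complex k H).
Local Notation vx x := (ext_const (edge G) (graph_var k x) : K).

Definition sub_koszul_map : KH -> K := koszul_map (sub_poly k H) (@sub_edge G H).
Local Notation j := sub_koszul_map.

Lemma sub_koszul_mapM u v : j (u * v) = j u * j v.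
Proof. exact: koszul_mapM. Qed.

Lemma sub_koszul_mapD u v : j (u + v) = j u + j v.
Proof. exact: koszul_mapD. Qed.

Lemma sub_koszul_map_d u : koszul_d (j u) = j (koszul_d u).
Proof. exact: (koszul_map_diff (@sub_poly_edge k G H)). Qed.

Lemma sub_koszul_map_bar u : ext_bar (j u) = j (ext_bar u).
Proof. exact: ext_bar_map. Qed.

Lemma sub_koszul_map_var (x : H) u :
  j (ext_const (edge H) (graph_var k x) * u) = vx (val x) * j u.
Proof. by rewrite /j koszul_mapC sub_poly_var. Qed.

Lemma sub_edge_adj (x y : H) : adj x y -> adj (val x) (val y).
Proof. by move=> /sub_adjP /and3P []. Qed.

Lemma sub_koszul_map_edge_gen (x y : H) : adj x y ->
  j (edge_gen k x y) = edge_gen k (val x) (val y).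
Proof.
move=> xy; pose e : edge H := Sub _ (is_edge_adj xy).
rewrite (@edge_genE k H x y e) // /j koszul_map_gen (@edge_genE k G _ _ (sub_edge e)) //.
by rewrite /= imsetU1 imset_set1.
Qed.

Lemma sub_koszul_map_prod (x : H) ys : all (adj x) ys ->
  j (\prod_(y <- ys) edge_gen k x y) =
  \prod_(y <- [seq val y | y <- ys]) edge_gen k (val x) y.
Proof.
elim: ys => [_|y ys IH /= /andP [xy xys]]; first by rewrite !big_nil; exact: koszul_map1.
by rewrite !big_cons sub_koszul_mapM sub_koszul_map_edge_gen // IH.
Qed.

(** The Leibniz rule for the edge from [x] to [b], with the variable of [x] cancelled. It links
    stars in the subgraph to stars using one more edge. *)
Lemma star_chain_cons (x : H) (b : G) ys : adj (val x) b -> all (adj x) ys ->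
  star_chain k (val x) (b :: [seq val y | y <- ys]) =
    vx b * j (\prod_(y <- ys) edge_gen k x y) -
    edge_gen k (val x) b * j (star_chain k x ys).
Proof.
move=> xb xys; apply: (@graph_var_cancel k G (val x)).
rewrite star_chainE /star_numerator big_cons koszul_d_edge_gen //.
rewrite -sub_koszul_map_prod // sub_koszul_map_d.
have -> : koszul_d (\prod_(y <- ys) edge_gen k x y) =
    ext_const (edge H) (graph_var k x) * star_chain k x ys by rewrite star_chainE.
rewrite (sub_koszul_map_var x).
rewrite ext_constM mulrBr.
rewrite -mulrA.
congr (_ - _).
by rewrite mulrA -ext_constC -mulrA.
Qed.

Definition kill_var (x : H) : {rmorphism graph_poly k H -> graph_poly k H} :=
  mmap (@mpolyC #|H| k) (fun i => if i == enum_rank x then 0 else 'X_i).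

Lemma kill_var_self x : kill_var x (graph_var k x) = 0.
Proof. by rewrite /kill_var /graph_var /= mmapX mmap1U eqxx. Qed.

Lemma kill_var_other (x y : H) : y != x -> kill_var x (graph_var k y) = graph_var k y.
Proof.
by move=> yx; rewrite /kill_var /graph_var /= mmapX mmap1U (inj_eq enum_rank_inj)
  (negPf yx).
Qed.

Lemma kill_var_div x (p : graph_poly k H) :
  exists q, p = kill_var x p + graph_var k x * q.
Proof.
move: p; apply: mpoly_ring_ind => [c|i|p q [p' ep] [q' eq]|p q [p' ep] [q' eq]].
- by exists 0; rewrite mulr0 addr0 /kill_var /= mmapC.
- rewrite -[i]enum_valK; have [->|ix] := eqVneq (enum_val i) x.
    by exists 1; rewrite kill_var_self add0r mulr1.
  by exists 0; rewrite kill_var_other // mulr0 addr0.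
- by exists (p' + q'); rewrite rmorphD mulrDr addrACA -ep -eq.
(* Obtained by expanding [p] first, and then [q] only in the product with [kill_var x p]. *)
exists (kill_var x p * q' + p' * q).
rewrite rmorphM mulrDr mulrCA addrA -mulrDr -eq mulrA -mulrDl.
by rewrite -ep.
Qed.

Variables (a : H) (b : G) (Q : K -> Prop).
Hypothesis adj_ab : adj (val a) b.
Hypothesis b_out : b \notin sub_vertices H.
Hypothesis QD : forall u v, Q u -> Q v -> Q (u + v).
Hypothesis QM : forall u v, Q u -> Q v -> Q (u * v).
Hypothesis Qd : forall u, Q (koszul_d u).
Hypothesis Qj : forall w, koszul_d w = 0 -> Q (j w).
Hypothesis Qstar : forall ys, ys != [::] -> uniq ys -> all (adj (val a)) ys ->
  Q (star_chain k (val a) ys).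
Local Notation E := (edge_gen k (val a) b).

Lemma sub_koszul_map_opp u : Q u -> Q (- u).
Proof.
move=> Qu; rewrite -mulN1r; apply: QM => //.
have -> : -1 = j (-1) by rewrite /j koszul_mapN koszul_map1.
by apply: Qj; rewrite /koszul_d koszul_diffN koszul_diff1 oppr0.
Qed.

(** By [star_spanP], [r] is built from three shapes, and for each the cycle is a boundary, a
    multiple of a star, or a sum of such cycles. *)
Lemma sub_star_cycle (x r : KH) :
  koszul_d r = ext_const (edge H) (graph_var k a) * x -> Q (E * j x - vx b * j r).
Proof.
(* The variable of [a] cancels, so [r] determines [x]. Any [x'] with the same property will do,
   which allows induction on the shape of [r]. *)
move=> dr; suff [x' dr' Qx'] : exists2 x',
    koszul_d r = ext_const (edge H) (graph_var k a) * x' & Q (E * j x' - vx b * j r).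
  by rewrite (@graph_var_cancel k H a x x') // -dr.
have : star_span (@edge_poly k H) (graph_var k a) (fun e => a \in val e) r.
  apply: (star_spanP (kill_var_self a) (kill_var_div a) _ _ dr) => e ae.
    rewrite /edge_poly rmorph_prod; apply: eq_bigr => y ye.
    by apply: kill_var_other; apply: contraNneq ae => <-.
  have [y ay ee] := edge_other_end k ae.
  by exists (graph_var k y); apply: edge_poly_adj ay ee.
elim=> {r dr x} [t|w L dw uL aL|u v _ [x dx Qx] _ [y dy Qy]].
- exists (koszul_d t); first exact: koszul_diffC.
  rewrite (sub_koszul_map_var a) -sub_koszul_map_d.
  have -> : E * koszul_d (j t) - vx b * (vx (val a) * j t) = - koszul_d (E * j t).
    by rewrite koszul_d_edge_gen // opprB ext_constM -ext_constC mulrA.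
  by apply: sub_koszul_map_opp.
- have [ys [ays uys eL]] : exists ys : seq H, [/\ all (adj a) ys, uniq ys &
      \prod_(e <- L) ext_gen (graph_poly k H) e = \prod_(y <- ys) edge_gen k a y].
    have ends (e : edge H) : exists y, a \in val e -> adj a y /\ val e = [set a; y].
      (* For edges not containing [a] the vertex [a] itself is a dummy value. *)
      have [ae|nae] := boolP (a \in val e); last by exists a.
      by have [y ay ee] := edge_other_end k ae; exists y.
    have [o oP] := choice ends.
    exists (map o L); split.
    + by rewrite all_map; apply: sub_all aL => e ae; case: (oP e ae).
    + rewrite map_inj_in_uniq // => e e' /(allP aL) ae /(allP aL) ae' oee.
      have [_ ee] := oP e ae; have [_ ee'] := oP e' ae'.
      by apply: val_inj; rewrite ee ee' oee.
    rewrite big_map; apply: eq_big_seq => e /(allP aL) ae.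
    by have [_ ee] := oP e ae; rewrite (edge_genE k ee).
  (* As [w] is a cycle, the boundary of its product with the generators is [ext_bar w] times the
     boundary of these generators, that is, times [a] and their star. *)
  rewrite eL; exists (ext_bar w * star_chain k a ys).
    rewrite /koszul_d koszul_diffM dw mul0r add0r.
    have -> : koszul_diff (@edge_poly k H) (\prod_(y <- ys) edge_gen k a y) =
      ext_const (edge H) (graph_var k a) * star_chain k a ys by rewrite star_chainE.
    by rewrite mulrA -ext_constC -mulrA.
  have -> : E * j (ext_bar w * star_chain k a ys) -
      vx b * j (w * \prod_(y <- ys) edge_gen k a y) =
      - (j w * star_chain k (val a) (b :: [seq val y | y <- ys])).
    have Ew : E * j (ext_bar w) = j w * E.
      pose e : edge G := Sub _ (is_edge_adj adj_ab).
      by rewrite (@edge_genE k G _ _ e) // ext_gen_bar sub_koszul_map_bar ext_barK.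
    rewrite star_chain_cons // !sub_koszul_mapM mulrBr opprB; congr (_ - _).
      by rewrite mulrA Ew -mulrA.
    by rewrite mulrA ext_constC -mulrA.
  apply: sub_koszul_map_opp; apply: QM; first exact: Qj.
  apply: Qstar => //=.
    rewrite map_inj_uniq ?uys ?andbT; last exact: val_inj.
    by apply/mapP => -[y _ by_]; move: b_out; rewrite by_ (valP y).
  rewrite adj_ab all_map /=; apply: sub_all ays => y; exact: sub_edge_adj.
- exists (x + y); first by rewrite /koszul_d koszul_diffD mulrDr; congr (_ + _).
  have -> : E * j (x + y) - vx b * j (u + v) =
      (E * j x - vx b * j u) + (E * j y - vx b * j v).
    by rewrite !sub_koszul_mapD !mulrDr opprD addrACA.
  exact: QD.
Qed.

End SubgraphStars.

(** * Graphs with a bridge *)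

Lemma ext_const_mulDr (A : comNzRingType) (I : finType) p (u e v : exterior A I) :
  ext_const I p * (u + e * v) = ext_const I p * u + e * (ext_const I p * v).
Proof. by rewrite mulrDr [in LHS]mulrA [ext_const I p * e]ext_constC -mulrA. Qed.

Lemma ext_gen_mulDr (A : comNzRingType) (I : finType) i j (u v : exterior A I) :
  ext_gen A i * (u + ext_gen A j * v) =
  ext_gen A i * u + ext_gen A j * - (ext_gen A i * v).
Proof. by rewrite mulrDr [in LHS]mulrA ext_genC mulNr mulrN mulrA. Qed.

Lemma ext_constMM (A : comNzRingType) (I : finType) p q (u v : exterior A I) :
  ext_const I (p * q) * (u * v) = ext_const I p * u * (ext_const I q * v).
Proof. by rewrite ext_constM -!mulrA; congr (_ * _); rewrite !mulrA ext_constC. Qed.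

Lemma ext_const_factorr (A : comNzRingType) (I : finType) p (e u v w : exterior A I) :
  e * (u * v) - w * (ext_const I p * v) = (e * u - ext_const I p * w) * v.
Proof. by rewrite mulrBl !mulrA -ext_constC. Qed.

Lemma ext_gen_factorl (A : comNzRingType) (I : finType) p i (u v w : exterior A I) :
  ext_gen A i * (u * v) - ext_const I p * ext_bar u * w =
  ext_bar u * (ext_gen A i * v - ext_const I p * w).
Proof. by rewrite mulrBr !mulrA ext_gen_bar -[in RHS]ext_constC. Qed.

Section BridgedGraph.
Variables (k : fieldType) (G : sgraph) (a b : G) (Ga Gb : subgraph G).
Hypothesis adj_ab : adj a b.
Hypothesis a_in : a \in sub_vertices Ga.
Hypothesis b_in : b \in sub_vertices Gb.
Hypothesis V_disj : [disjoint sub_vertices Ga & sub_vertices Gb].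
Hypothesis V_union : sub_vertices Ga :|: sub_vertices Gb = [set: G].
Hypothesis E_union : forall x y : G,
  @adj (del_edge a b) x y = sub_adj Ga x y || sub_adj Gb x y.

Local Notation K := (koszul_complex k G).
Local Notation Ka := (koszul_complex k Ga).
Local Notation Kb := (koszul_complex k Gb).
Local Notation ja := (@sub_koszul_map k G Ga).
Local Notation jb := (@sub_koszul_map k G Gb).
Local Notation vx x := (ext_const (edge G) (graph_var k x) : K).
Local Notation E := (edge_gen k a b).
Let va : Ga := Sub a a_in.
Let vb : Gb := Sub b b_in.

Lemma b_out : b \notin sub_vertices Ga.
Proof. by apply/negP => bGa; move/pred0P/(_ b): V_disj; rewrite /= bGa b_in. Qed.

Lemma a_out : a \notin sub_vertices Gb.
Proof. by apply/negP => aGb; move/pred0P/(_ a): V_disj; rewrite /= aGb a_in. Qed.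

Lemma sub_edge_inj (H : subgraph G) : injective (@sub_edge G H).
Proof.
move=> e e' /(congr1 val) /= ee; apply: val_inj.
by apply: imset_inj ee; exact: val_inj.
Qed.

Lemma sub_edge_vertices (H : subgraph G) (e : edge H) x :
  x \in val (sub_edge e) -> x \in sub_vertices H.
Proof. by move=> /imsetP [y _ ->]; exact: valP. Qed.

Lemma edge_vertex (H : sgraph) (e : edge H) : exists x, x \in val e.
Proof. by have [x [y [_ -> _]]] := edge_polyE k e; exists x; rewrite set21. Qed.

Lemma sub_edges_disjoint (e : edge Ga) (e' : edge Gb) : sub_edge e != sub_edge e'.
Proof.
apply/eqP => ee; have [x xe] := edge_vertex (sub_edge e).
have xa := sub_edge_vertices xe; rewrite ee in xe.
have xb := sub_edge_vertices xe.
by move/pred0P/(_ x): V_disj; rewrite /= xa xb.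
Qed.

Lemma edge_cases (e : edge G) :
  [\/ val e = [set a; b], exists e', e = @sub_edge G Ga e' |
      exists e', e = @sub_edge G Gb e'].
Proof.
have sub (H : subgraph G) x y : val e = [set x; y] -> sub_adj H x y ->
    exists e', e = @sub_edge G H e'.
  move=> ee xy; have /and3P [xH yH _] := sub_adjP xy.
  have xy' : @adj H (Sub x xH) (Sub y yH) by [].
  exists (Sub _ (is_edge_adj xy')); apply: val_inj.
  by rewrite /= imsetU1 imset_set1.
have [x [y [xy ee _]]] := edge_polyE k e.
have [ab|nab] := eqVneq (val e) [set a; b]; first by constructor 1.
have : @adj (del_edge a b) x y by rewrite /= /del_edge_adj xy -ee nab.
rewrite E_union => /orP [/(sub _ _ _ ee)|/(sub _ _ _ ee)] H.
- by constructor 2.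
- by constructor 3.
Qed.

Lemma sub_polyZ (H : subgraph G) c p : sub_poly k H (c *: p) = c *: sub_poly k H p.
Proof. by rewrite /sub_poly /= mmapZ mul_mpolyC. Qed.

Definition sub_index (H : subgraph G) (i : 'I_#|H|) : 'I_#|G| :=
  enum_rank (val (enum_val i : H)).

Lemma sub_polyX (H : subgraph G) (i : 'I_#|H|) : sub_poly k H 'X_i = 'X_(sub_index i).
Proof. by rewrite /sub_poly /= mmapX mmap1U. Qed.

Lemma sub_index_inj (H : subgraph G) : injective (@sub_index H).
Proof. by move=> i j /enum_rank_inj /val_inj /enum_val_inj. Qed.

Lemma sub_index_disjoint (i : 'I_#|Ga|) (j : 'I_#|Gb|) : sub_index i != sub_index j.
Proof.
apply/eqP => /enum_rank_inj e; move/pred0P/(_ (val (enum_val i : Ga))): V_disj.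
by rewrite /= (valP (enum_val i : Ga)) e (valP (enum_val j : Gb)).
Qed.

Lemma sub_koszul_map_linear (H : subgraph G) : linear (@sub_koszul_map k G H).
Proof. by apply: koszul_map_linear; exact: sub_polyZ. Qed.

Lemma sub_koszul_tensor_map (f : Ka -> Ka) (g : Kb -> Kb) : linear f -> linear g ->
  exists2 L : K -> K, linear L & forall p q, L (ja p * jb q) = ja (f p) * jb (g q).
Proof.
move=> lf lg.
apply: (@koszul_tensor_lift k #|Ga| #|Gb| #|G| (edge Ga) (edge Gb) (edge G)
  (sub_poly k Ga) (@sub_index Ga) (@sub_edge G Ga)
  (sub_poly k Gb) (@sub_index Gb) (@sub_edge G Gb) _ _ _ _ _ _ _ _ _ _ K
  (fun p q => ja (f p) * jb (g q))).
all: try by [exact: sub_polyZ | exact: sub_polyX | exact: sub_edge_inj |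
  exact: sub_index_inj | exact: sub_index_disjoint | exact: sub_edges_disjoint].
- by move=> p c u v; rewrite lg sub_koszul_map_linear mulrDr scalerAr.
- by move=> q c u v; rewrite lf sub_koszul_map_linear mulrDl scalerAl.
Qed.

Local Notation tensor := (tensor_sum ja jb).

(** It is enough to treat scalars and single variables. A variable belongs to one of the two sides
    and is absorbed by the corresponding factor. *)
Lemma tensor_const p u : tensor u -> tensor (ext_const (edge G) p * u).
Proof.
move: p u; apply: mpoly_ring_ind => [c|i|p q IHp IHq|p q IHp IHq] u tu.
- rewrite -[c%:MP]mulr1 mul_mpolyC -ext_scaleE.
  move: u tu; apply: tensor_sum_image => [c' u v|p q].
    by rewrite scalerDr !scalerA mulrC.
  rewrite scalerAl -(linearZE _ _ (@sub_koszul_map_linear Ga)).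
  exact: tensor_sum1.
- move: u tu; apply: tensor_sum_image => [|p q]; first exact: ext_const_mul_linear.
  have : enum_val i \in sub_vertices Ga :|: sub_vertices Gb by rewrite V_union.
  rewrite -[X in 'X_X]enum_valK -[ 'X_ _ ]/(graph_var k (enum_val i)).
  case/setUP => iH.
    rewrite mulrA -(@sub_koszul_map_var k G Ga (Sub (enum_val i) iH)).
    exact: tensor_sum1.
  rewrite mulrA ext_constC -mulrA -(@sub_koszul_map_var k G Gb (Sub (enum_val i) iH)).
  exact: tensor_sum1.
- by rewrite ext_constD mulrDl; apply: tensor_sumD; [exact: IHp | exact: IHq].
- by rewrite ext_constM -mulrA; apply/IHp/IHq.
Qed.

Lemma tensor_gen_a e u : tensor u -> tensor (ext_gen _ (@sub_edge G Ga e) * u).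
Proof.
move: u; apply: tensor_sum_image => [c u v|p q].
  by rewrite mulrDr ext_scaleAr.
rewrite mulrA -(koszul_map_genM (sub_poly k Ga)).
exact: (tensor_sum1 ja jb).
Qed.

Lemma tensor_gen_b e u : tensor u -> tensor (ext_gen _ (@sub_edge G Gb e) * u).
Proof.
move: u; apply: tensor_sum_image => [c u v|p q].
  by rewrite mulrDr ext_scaleAr.
rewrite mulrA ext_gen_bar sub_koszul_map_bar -mulrA -(koszul_map_genM (sub_poly k Gb)).
exact: (tensor_sum1 ja jb).
Qed.

Let bridge : edge G := Sub _ (is_edge_adj adj_ab).

Lemma bridgeE : E = ext_gen (graph_poly k G) bridge.
Proof. by rewrite (@edge_genE k G a b bridge). Qed.

(** Scalars and generators of either side preserve this form, up to a sign on [v]. The bridge turns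
    [u + E * v] into [E * u], because its square is 0. *)
Lemma bridged_decomposition z :
  exists u v, [/\ tensor u, tensor v & z = u + E * v].
Proof.
have t0 : tensor 0 by exact: tensor_sum0.
move: z; apply: ext_ind => [|z z' [u [v [tu tv ->]]] [u' [v' [tu' tv' ->]]]
    |p z [u [v [tu tv ->]]]|e z [u [v [tu tv ->]]]].
- exists (ja 1 * jb 1), 0; split=> //; first exact: tensor_sum1.
  by rewrite /ja /jb !koszul_map1 mulr1 mulr0 addr0.
- exists (u + u'), (v + v'); split; [exact: tensor_sumD|exact: tensor_sumD|].
  by rewrite mulrDr addrACA.
- exists (ext_const (edge G) p * u), (ext_const (edge G) p * v).
  split; [exact: tensor_const|exact: tensor_const|].
  exact: ext_const_mulDr.
have tN w : tensor w -> tensor (- w).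
  by apply: tensor_sumN; exact: sub_koszul_map_linear.
have [ee|[e' ee]|[e' ee]] := edge_cases e.
- exists 0, u; split=> //.
  have -> : e = bridge by apply: val_inj.
  by rewrite bridgeE mulrDr mulrA ext_gen_sq mul0r addr0 add0r.
- exists (ext_gen (graph_poly k G) e * u), (- (ext_gen (graph_poly k G) e * v)).
  rewrite bridgeE ext_gen_mulDr; split=> //.
    by rewrite ee; exact: tensor_gen_a.
  by apply: tN; rewrite ee; exact: tensor_gen_a.
- exists (ext_gen (graph_poly k G) e * u), (- (ext_gen (graph_poly k G) e * v)).
  rewrite bridgeE ext_gen_mulDr; split=> //.
    by rewrite ee; exact: tensor_gen_b.
  by apply: tN; rewrite ee; exact: tensor_gen_b.
Qed.

Local Notation del := (koszul_diff (fun e : edge G => (e == bridge)%:R : graph_poly k G)).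

(** A subgraph missing an end of the bridge does not contain the bridge, so the contraction pulls
    back to the zero differential. *)
Lemma del_bridge_sub (H : subgraph G) (u : koszul_complex k H) :
  (a \notin sub_vertices H) || (b \notin sub_vertices H) -> del (sub_koszul_map u) = 0.
Proof.
move=> out; rewrite (@koszul_map_diff _ _ _ _ _ _ (fun=> 0)) => [|e].
  have -> : koszul_diff (fun=> 0) u = 0.
    by apply/ffunP => S; rewrite !ffunE big1 // => e _; rewrite mulr0 mul0r.
  exact: koszul_map0.
rewrite rmorph0; case: eqP => // ee.
have sub x : x \in [set a; b] -> x \in sub_vertices H.
  by move=> xab; apply: (@sub_edge_vertices H e); rewrite ee.
by move: out; rewrite !sub ?set21 ?set22.
Qed.

(** An instance of [tensor_cycle_ind] with [m] the multiplication by the product of both end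
    variables. From each corrected cycle one factor splits off as a cycle of one side;
    [sub_star_cycle] handles the other. *)
Lemma bridged_cycle_ind (Q : K -> Prop) :
  (forall u v, Q u -> Q v -> Q (u + v)) ->
  (forall u v, Q u -> Q v -> Q (u * v)) ->
  (forall w, Q (koszul_d w)) ->
  (forall w : Ka, koszul_d w = 0 -> Q (ja w)) ->
  (forall w : Kb, koszul_d w = 0 -> Q (jb w)) ->
  (forall ys, ys != [::] -> uniq ys -> all (adj a) ys -> Q (star_chain k a ys)) ->
  (forall ys, ys != [::] -> uniq ys -> all (adj b) ys -> Q (star_chain k b ys)) ->
  forall z, koszul_d z = 0 -> Q z.
Proof.
move=> QD QM Qd Qja Qjb Qsa Qsb.
pose la (p : Ka) : Ka := ext_const (edge Ga) (graph_var k va) * p.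
pose lb (q : Kb) : Kb := ext_const (edge Gb) (graph_var k vb) * q.
pose m (u : K) : K := ext_const (edge G) (graph_var k a * graph_var k b) * u.
apply: (@tensor_cycle_ind k Ka Kb K ja jb E (@koszul_d k Ga) (@ext_bar _ _) la
  (@koszul_d k Gb) lb (@koszul_d k G) m del).
- exact: sub_koszul_map_linear.
- exact: sub_koszul_map_linear.
- exact: koszul_diff_linear.
- exact: ext_bar_linear.
- exact: ext_const_mul_linear.
- exact: koszul_diff_linear.
- exact: ext_const_mul_linear.
- exact: koszul_diff_linear.
- exact: ext_const_mul_linear.
- exact: koszul_diff_linear.
- exact: koszul_diffK.
- exact: koszul_diffK.
- exact: koszul_diffK.
- exact: ext_barK.
- exact: koszul_diff_bar.
- by move=> p; rewrite /la ext_barC.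
- by move=> p; exact: koszul_diffC.
- by move=> q; exact: koszul_diffC.
- move=> p q; rewrite -!sub_koszul_map_d -sub_koszul_map_bar.
  exact: koszul_diffM.
- move=> p q; rewrite /m /la /lb !sub_koszul_map_var.
  exact: ext_constMM.
- by move=> u; exact: koszul_d_edge_gen.
- move=> p q; rewrite koszul_diffM !del_bridge_sub ?b_out ?a_out ?orbT //.
  by rewrite mul0r mulr0 addr0.
- by move=> u; rewrite bridgeE koszul_diff_genM eqxx ext_const1 mul1r.
- exact: sub_koszul_tensor_map.
- exact: bridged_decomposition.
- exact: QD.
- exact: Qd.
- by move=> x y dx dy; apply: QM; [exact: Qja | exact: Qjb].
- move=> x r y _ ax dy; rewrite /lb sub_koszul_map_var.
  rewrite [X in Q X](_ : _ = (E * ja x - vx b * ja r) * jb y); last first.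
    exact: ext_const_factorr.
  apply: (QM); last exact: Qjb.
  by apply: (@sub_star_cycle k G Ga va b) => //; exact: b_out.
move=> x y r dx _ by_; rewrite /la sub_koszul_map_var.
(* The bridge is an unordered pair, so the roles of [a] and [b] can be exchanged. *)
have Eba : E = edge_gen k b a by rewrite /edge_gen setUC.
rewrite [X in Q X](_ : _ = ja (ext_bar x) * (edge_gen k b a * jb y - vx a * jb r)); last first.
  by rewrite -Eba bridgeE -sub_koszul_map_bar; exact: ext_gen_factorl.
apply: (QM); first by apply: Qja; exact: koszul_diff_bar_cycle.
apply: (@sub_star_cycle k G Gb vb a) => //; first by rewrite adj_sym.
exact: a_out.
Qed.

End BridgedGraph.

(** * From cycles to generators of the homology algebra *)

Theorem theorem57 (k : fieldType) (G : sgraph) (a b : G) (Ga Gb : subgraph G)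
  (adj_ab : adj a b)
  (a_in_Ga : a \in sub_vertices Ga) (b_in_Gb : b \in sub_vertices Gb)
  (vertices_disjoint : [disjoint sub_vertices Ga & sub_vertices Gb])
  (vertices_union : sub_vertices Ga :|: sub_vertices Gb = [set: G])
  (edges_union : forall x y : G,
     @adj (del_edge a b) x y = sub_adj Ga x y || sub_adj Gb x y) :
  generates_algebra (fun h : graph_homology k G =>
    [\/ exists z : graph_homology k Ga, h = sub_homology_map z,
        exists z : graph_homology k Gb, h = sub_homology_map z,
        exists ys : seq G,
          [/\ ys != [::], uniq ys, all (adj a) ys & h = star k a ys]
      | exists ys : seq G,
          [/\ ys != [::], uniq ys, all (adj b) ys & h = star k b ys] ]).
Proof.
move=> S Ssub Sgen.
have SD h h' : h \in S -> h' \in S -> h + h' \in S.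
  by case: Ssub => _ Slin _ hS h'S; rewrite -[h]scale1r; apply: Slin.
have SM h h' : h \in S -> h' \in S -> h * h' \in S by case: Ssub => _ _; apply.
have S0 : 0 \in S.
  by case: Ssub => S1 Slin _; rewrite -[0](addNr 1) -scaleN1r; apply: Slin.
(* The proof that [u] is a cycle is packed into the predicate, so that [Q] is defined on all
   chains. *)
pose Q (u : koszul_complex k G) :=
  exists2 z : graph_cycles k G, val z = u & homology_class z \in S.
have Q_sub (H : subgraph G) (w : koszul_complex k H) :
    (forall z, @sub_homology_map k G H z \in S) ->
    koszul_d w = 0 -> Q (sub_koszul_map w).
  move=> SH dw; have cw : w \in koszul_cycle (@edge_poly k H) by apply/koszul_cycleP.
  exists (koszul_cycles_map (@sub_poly_edge k G H) (KoszulCycle cw)) => //.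
  by rewrite /homology_class -koszul_homology_mapE; exact: SH.
have Q_all z : koszul_d z = 0 -> Q z.
  apply: (@bridged_cycle_ind k G a b Ga Gb) => //.
  - move=> _ _ [z1 <- S1] [z2 <- S2]; exists (z1 + z2) => //.
    by rewrite /homology_class koszul_classD; apply: SD.
  - move=> _ _ [z1 <- S1] [z2 <- S2]; exists (z1 * z2) => //.
    by rewrite /homology_class koszul_classM; apply: SM.
  - move=> w; have cw : koszul_d w \in koszul_cycle (@edge_poly k G).
      by apply/koszul_cycleP; exact: koszul_diffK.
    exists (KoszulCycle cw) => //.
    suff -> : homology_class (KoszulCycle cw) = 0 by [].
    rewrite -(subrr (koszul_class 0)) -koszul_classB subrr.
    by apply/koszul_class_eq; rewrite subr0; apply/koszul_boundaryP; exists w.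
  - by move=> w; apply: Q_sub => h; apply: Sgen; constructor 1; exists h.
  - by move=> w; apply: Q_sub => h; apply: Sgen; constructor 2; exists h.
  - move=> ys ys0 uys ays; exists (KoszulCycle (star_chain_cycle k a ys)) => //.
    by apply: Sgen; constructor 3; exists ys.
  - move=> ys ys0 uys ays; exists (KoszulCycle (star_chain_cycle k b ys)) => //.
    by apply: Sgen; constructor 4; exists ys.
move=> h; have [z ->] := koszul_classP h.
have [|z' ez zS] := Q_all (val z); first by apply/koszul_cycleP; exact: valP.
by rewrite (_ : z = z') //; apply: val_inj.
Qed.
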